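(* Let $p_1,\ldots,p_7$ be seven points of $\mathbb{P}^2(\mathbb{C})$ in general position. Let $\mathcal{F}$ be the quadratic (i.e. degree $2$) foliation of $\mathbb{P}^2(\mathbb{C})$ whose singular locus is $\{p_1,\ldots,p_7\}$, and let $\mathcal{I}_G=\mathcal{I}_G(p_1,\ldots,p_7)$ be the Geiser involution associated to $p_1,\ldots,p_7$. Then the birational involution $\mathcal{I}_{\mathcal{F}}$ associated to $\mathcal{F}$ and the Geiser involution $\mathcal{I}_G$ coincide.
   Context: General position: seven points of $\mathbb{P}^2(\mathbb{C})$ are in general position if no three of them are collinear and no six of them lie on a conic. Foliations: a foliation $\mathcal{F}$ of degree $\nu$ on $\mathbb{P}^2(\mathbb{C})$ is given by a $1$-form $\omega=u\,dx+v\,dy+w\,dz$ on $\mathbb{C}^3$, with $u,v,w$ homogeneous polynomials of degree $\nu+1$ without common factor satisfying $xu+yv+zw=0$. Its singular locus is the projectivization of $\{u=v=w=0\}$. The degree $\nu$ is the number of tangency points of $\mathcal{F}$ with a generic line. $\mathcal{L}_m$ denotes the leaf of $\mathcal{F}$ through a regular point $m$ and $T_m\mathcal{L}_m$ its (projective) tangent line at $m$. Known fact: given seven points in general position there is one and only one quadratic foliation having these seven points as its singular points. Involution associated to a quadratic foliation: if $\mathcal{F}$ has degree $2$ and $m$ is a generic point, the line $T_m\mathcal{L}_m$ is tangent to $\mathcal{F}$ at $m$ and at exactly one second point $m'$; $\mathcal{I}_{\mathcal{F}}$ is the birational involution of $\mathbb{P}^2(\mathbb{C})$ defined by $m\mapsto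 m'$. Geiser involution: let $L$ be the linear system (of projective dimension $2$) of cubics through $p_1,\ldots,p_7$. For a generic point $p$ of $\mathbb{P}^2(\mathbb{C})$, the elements of $L$ passing through $p$ form a pencil $L_p$, which has nine base points: $p_1,\dots,p_7$, $p$ and a ninth one, denoted $\mathcal{I}_G(p)$. The map $p\mapsto\mathcal{I}_G(p)$ is a birational involution, the Geiser involution $\mathcal{I}_G(p_1,\ldots,p_7)$. *)

(* Defs.v *)
From HB Require Import structures.
From mathcomp Require Import all_boot all_order all_algebra.
From mathcomp Require Import reals complex.
From mathcomp Require Import mpoly.

Set Implicit Arguments.
Unset Strict Implicit.
Unset Printing Implicit Defensive.

Import GRing.Theory.
Local Open Scope ring_scope.

(** Points of P^2(K) are given by homogeneous coordinates. [point K] is not a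
    quotient: equality of points is [same_point], i.e. equality of the lines of
    K^3 spanned by the coordinate vectors. *)
Definition point (K : fieldType) := {x : 'rV[K]_3 | x != 0}.

Definition same_point (K : fieldType) (x y : point K) : bool :=
  (val x == val y)%MS.

Definition evalpt (K : fieldType) (f : {mpoly K[3]}) (x : point K) : K :=
  f.@[val x 0].

Definition eval3 (K : fieldType) (f : 'I_3 -> {mpoly K[3]}) (x : point K) :
  'rV[K]_3 := \row_i evalpt (f i) x.

(** [P] holds on a nonempty Zariski open subset of P^2(K). *)
Definition generically (K : fieldType) (P : point K -> Prop) : Prop :=
  exists h : {mpoly K[3]}, [/\ h != 0, exists d : nat, h \is d.-homog
    & forall x : point K, evalpt h x != 0 -> P x].

(** Possibly reducible curves are allowed. *)
Definition on_curve_of_degree (K : fieldType) (d : nat) (I : finType)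
    (p : I -> point K) (A : {set I}) : Prop :=
  exists f : {mpoly K[3]}, [/\ f != 0, f \is d.-homog
    & forall i, i \in A -> evalpt f (p i) = 0].

(** The first condition forces the seven points to be pairwise distinct. *)
Definition general_position (K : fieldType) (p : 'I_7 -> point K) : Prop :=
  (forall A : {set 'I_7}, #|A| = 3%N -> ~ on_curve_of_degree 1 p A) /\
  (forall A : {set 'I_7}, #|A| = 6%N -> ~ on_curve_of_degree 2 p A).

(** A rational self-map of P^2, given by a representative; a common factor is
    allowed, so that equality of rational maps is [ratmap_eq]. *)
Record ratmap (K : fieldType) := RatMap {
  ratmap_coord :> 'I_3 -> {mpoly K[3]};
  ratmap_deg : nat;
  ratmap_homog : forall i, ratmap_coord i \is ratmap_deg.-homog;
  ratmap_neq0 : exists i, ratmap_coord i != 0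
}.

Definition ratmap_eq (K : fieldType) (f g : ratmap K) : Prop :=
  forall i j, f i * g j = f j * g i.

(** [f] is defined at [x] with value [y]: as [val y != 0], the equality of row
    spaces forces [eval3 f x != 0]. *)
Definition ratmap_at (K : fieldType) (f : ratmap K) (x y : point K) : bool :=
  (eval3 f x == val y)%MS.

Definition birational_involution (K : fieldType) (f : ratmap K) : Prop :=
  generically (fun x => exists y, ratmap_at f x y /\ ratmap_at f y x).

(** The 1-form u dx + v dy + w dz defining a foliation of degree [nu]. The last
    field also excludes u = v = w = 0. *)
Record foliation (K : fieldType) (nu : nat) := Foliation {
  fol_coef :> 'I_3 -> {mpoly K[3]};
  fol_homog : forall i, fol_coef i \is nu.+1.-homog;
  fol_euler : \sum_i 'X_i * fol_coef i = 0;
  fol_coprime : forall d : {mpoly K[3]},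
    (forall i, exists q, fol_coef i = d * q) -> exists c : K, d = c%:MP
}.

Definition singular (K : fieldType) (nu : nat) (F : foliation K nu)
    (x : point K) : bool := eval3 F x == 0.

(** Coordinates (a, b, c) of the line a x + b y + c z = 0 tangent at [m] to the
    leaf through [m], for [m] regular: the leaf is an integral curve of
    u dx + v dy + w dz, and the line contains [m] by [fol_euler]. *)
Definition tangent_line (K : fieldType) (nu : nat) (F : foliation K nu)
    (m : point K) : 'rV[K]_3 := eval3 F m.

Definition on_line (K : fieldType) (l : 'rV[K]_3) (q : point K) : Prop :=
  \sum_i l 0 i * val q 0 i = 0.

Definition line_tangent_at (K : fieldType) (nu : nat) (F : foliation K nu)
    (l : 'rV[K]_3) (q : point K) : Prop :=
  [/\ ~~ singular F q, on_line l q & (tangent_line F q == l)%MS].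

Definition second_tangency_point (K : fieldType) (nu : nat)
    (F : foliation K nu) (m m' : point K) : Prop :=
  [/\ ~~ singular F m, ~~ same_point m' m
    & forall q, line_tangent_at F (tangent_line F m) q <->
                same_point q m \/ same_point q m'].

Definition foliation_involution (K : fieldType) (F : foliation K 2)
    (f : ratmap K) : Prop :=
  birational_involution f /\
  generically (fun m => exists m', second_tangency_point F m m' /\
                                   ratmap_at f m m').

Definition cubic_system (K : fieldType) (p : 'I_7 -> point K)
    (f : {mpoly K[3]}) : Prop :=
  f \is 3.-homog /\ forall i, evalpt f (p i) = 0.

Definition pencil_base_point (K : fieldType) (p : 'I_7 -> point K)
    (m q : point K) : Prop :=
  forall f, cubic_system p f -> evalpt f m = 0 -> evalpt f q = 0.

(** For generic [m] the nine base points are distinct, so no multiplicities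
    are needed. *)
Definition ninth_base_point (K : fieldType) (p : 'I_7 -> point K)
    (m m' : point K) : Prop :=
  [/\ forall i, ~~ same_point m (p i), forall i, ~~ same_point m' (p i),
      ~~ same_point m' m
    & forall q, pencil_base_point p m q <->
        [\/ exists i, same_point q (p i), same_point q m | same_point q m']].

Definition geiser_involution (K : fieldType) (p : 'I_7 -> point K)
    (f : ratmap K) : Prop :=
  birational_involution f /\
  generically (fun m => exists m', ninth_base_point p m m' /\
                                   ratmap_at f m m').

(* Main.v *)
Require Import Defs.
From HB Require Import structures.
From mathcomp Require Import all_boot all_order all_algebra.
From mathcomp Require Import reals complex.
From mathcomp Require Import mpoly.
From mathcomp Require Import ring.

Set Implicit Arguments.
Unset Strict Implicit.
Unset Printing Implicit Defensive.

Import GRing.Theory Num.Theory.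
Local Open Scope ring_scope.

(** Write the foliation as a map F = (u, v, w) of cubics, so that F(m) is both
    the value of the 1-form and the tangent line at m. Two remarks make the two
    involutions equal.

    - The cubics through p_1, ..., p_7 are the combinations of u, v, w. Indeed
      the ten-dimensional space of cubics loses exactly seven dimensions when
      the points are imposed, because three lines separate each point from the
      six others ([separating_cubic]), and u, v, w are independent: otherwise
      all tangent lines would pass through one point, although a line avoiding
      that point and the p_i is tangent to the foliation somewhere
      ([fol_free], [cubic_system_span]).
    - Hence q is a base point of the pencil of cubics through m exactly when
      F(q) is proportional to F(m) ([pencil_base_pointP]): either F(q) = 0 and
      q is some p_i, or the tangent lines at q and at m are the same. So the
      ninth base point is the second tangency point
      ([second_tangency_ninth_base]), and uniqueness of the involution follows
      by density ([foliation_involution_unique]).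

    The remaining part is that the involution exists as a rational map. On the
    line through x and y, F(s x + t y) is orthogonal to s x + t y, and therefore
    its products with y and x are s Q(s, t) and - t Q(s, t) for a binary
    quadratic form Q, whose zeros are the tangency points
    ([tangency_form_eq0P]). If the line is the tangent at x, then t divides Q and
    the other zero is rational in x; this gives explicit coordinates
    ([second_root]). They define an involution provided that Q is not
    degenerate for some tangent line. Here general position enters a second
    time: on the line p_1 p_2 the form Q is a nonzero multiple of s t
    ([tangency_disc_base]): otherwise there would be an eighth singular point,
    unless the derivative of F at p_1 in the direction of p_2, or that at p_2 in
    the direction of p_1, is zero, and the union of the line p_1 p_3 with the
    conic through p_2, p_4, ..., p_7 excludes this ([mixed_cubic]). Moving the
    line p_1 p_2 a little, one avoids the p_i and keeps two distinct tangency
    points ([good_line]). *)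

(** * Vectors of length three *)

Notation o0 := (@Ordinal 3 0 isT).
Notation o1 := (@Ordinal 3 1 isT).
Notation o2 := (@Ordinal 3 2 isT).

Lemma sum3E (V : nmodType) (f : 'I_3 -> V) :
  \sum_i f i = f o0 + f o1 + f o2.
Proof.
rewrite !big_ord_recl big_ord0 addr0 addrA.
by congr (_ + _ + _); congr (f _); apply: val_inj.
Qed.

Lemma ord3P (P : 'I_3 -> Prop) : P o0 -> P o1 -> P o2 -> forall i, P i.
Proof.
by move=> P0 P1 P2 [[|[|[|//]]] lt3]; [move: P0 | move: P1 | move: P2];
  congr (P _); apply: val_inj.
Qed.

Section Vectors.
Variable R : comNzRingType.
Implicit Types x y z w : 'rV[R]_3.

Definition dotv x y : R := \sum_i x 0 i * y 0 i.

Definition crossv x y : 'rV[R]_3 :=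
  (* indices are taken modulo 3 *)
  \row_i (x 0 (i + 1) * y 0 (i + 2%:R) - x 0 (i + 2%:R) * y 0 (i + 1)).

Definition det3v x y z : R := dotv (crossv x y) z.

Lemma dotvE x y :
  dotv x y = x 0 o0 * y 0 o0 + x 0 o1 * y 0 o1 + x 0 o2 * y 0 o2.
Proof. exact: sum3E. Qed.

Lemma crossvE x y :
  [/\ crossv x y 0 o0 = x 0 o1 * y 0 o2 - x 0 o2 * y 0 o1,
      crossv x y 0 o1 = x 0 o2 * y 0 o0 - x 0 o0 * y 0 o2 &
      crossv x y 0 o2 = x 0 o0 * y 0 o1 - x 0 o1 * y 0 o0].
Proof.
by split; rewrite mxE; congr (x 0 _ * y 0 _ - x 0 _ * y 0 _); apply: val_inj.
Qed.

Definition crossv0 x y := let: And3 e _ _ := crossvE x y in e.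
Definition crossv1 x y := let: And3 _ e _ := crossvE x y in e.
Definition crossv2 x y := let: And3 _ _ e := crossvE x y in e.

Lemma row3P x y : x 0 o0 = y 0 o0 -> x 0 o1 = y 0 o1 -> x 0 o2 = y 0 o2 -> x = y.
Proof. by move=> e0 e1 e2; apply/rowP; apply: ord3P. Qed.

Definition vecE := (dotvE, crossv0, crossv1, crossv2).
End Vectors.

Ltac vec_ring :=
  rewrite /det3v;
  first [apply: row3P | idtac];
  rewrite ?(vecE, mxE) ; ring.

Section VectorTheory.
Variable R : comNzRingType.
Implicit Types x y z w : 'rV[R]_3.

Lemma dotvC x y : dotv x y = dotv y x. Proof. vec_ring. Qed.
Lemma dotvDl x y z : dotv (x + y) z = dotv x z + dotv y z.
Proof. vec_ring. Qed.
Lemma dotvDr x y z : dotv x (y + z) = dotv x y + dotv x z.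
Proof. vec_ring. Qed.
Lemma dotvZl a x y : dotv (a *: x) y = a * dotv x y. Proof. vec_ring. Qed.
Lemma dotvZr a x y : dotv x (a *: y) = a * dotv x y. Proof. vec_ring. Qed.
Lemma dotvNr x y : dotv x (- y) = - dotv x y. Proof. vec_ring. Qed.
Lemma dotv0l x : dotv 0 x = 0. Proof. vec_ring. Qed.
Lemma dotv0r x : dotv x 0 = 0. Proof. vec_ring. Qed.
Lemma crossvZl a x y : crossv (a *: x) y = a *: crossv x y. Proof. vec_ring. Qed.
Lemma crossvZr a x y : crossv x (a *: y) = a *: crossv x y. Proof. vec_ring. Qed.
Lemma crossv0l x : crossv 0 x = 0. Proof. vec_ring. Qed.
Lemma crossv0r x : crossv x 0 = 0. Proof. vec_ring. Qed.
Lemma crossvv x : crossv x x = 0. Proof. vec_ring. Qed.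
Lemma crossv_comb a b c d x y :
  crossv (a *: x + b *: y) (c *: x + d *: y) = (a * d - b * c) *: crossv x y.
Proof. vec_ring. Qed.
Lemma dotv_crossl x y : dotv (crossv x y) x = 0. Proof. vec_ring. Qed.
Lemma dotv_crossr x y : dotv (crossv x y) y = 0. Proof. vec_ring. Qed.
Lemma crossv_cross x y z :
  crossv x (crossv y z) = dotv x z *: y - dotv x y *: z.
Proof. vec_ring. Qed.

(** Cramer's rule for the coordinates of [w] in the basis [x], [y], [z]. *)
Lemma det3vE x y z w :
  det3v x y z *: w = det3v w y z *: x + det3v x w z *: y + det3v x y w *: z.
Proof. vec_ring. Qed.

End VectorTheory.

Section VectorField.
Variable K : fieldType.
Implicit Types x y z w : 'rV[K]_3.

Lemma row_eqmxP n (u v : 'rV[K]_n) :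
  reflect (exists2 c, c != 0 & u = c *: v) (u == v)%MS.
Proof.
apply: (iffP andP) => [[/sub_rVP[a ->] vu]|[c c0 ->]]; last first.
  split; first exact: scalemx_sub.
  by rewrite -{1}[v]scale1r -(mulVf c0) -scalerA scalemx_sub.
have [a0|a0] := eqVneq a 0; last by exists a.
case/sub_rVP: vu => b; rewrite a0 scale0r scaler0 => ->.
by exists 1; rewrite ?oner_eq0 ?scaler0.
Qed.

Lemma rV3_neq0 x : x != 0 -> exists i, x 0 i != 0.
Proof. by case/matrix0Pn => i [j]; rewrite ord1; exists j. Qed.

Lemma dotv_delta x i : dotv x (delta_mx 0 i) = x 0 i.
Proof.
rewrite /dotv (bigD1 i) //= big1 => [|j /negbTE ji]; rewrite mxE eqxx.
  by rewrite eqxx mulr1 addr0.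
by rewrite ji mulr0.
Qed.

Lemma dotv_all0 x : (forall y, dotv x y = 0) -> x = 0.
Proof. by move=> x0; apply/rowP => i; rewrite -dotv_delta x0 mxE. Qed.

Lemma ex_dotv_neq0 x : x != 0 -> exists y, dotv x y != 0.
Proof.
by case/rV3_neq0 => i xi; exists (delta_mx 0 i); rewrite dotv_delta.
Qed.

Lemma crossv_eq0 x y : crossv x y = 0 -> y != 0 -> exists c, x = c *: y.
Proof.
move=> xy /ex_dotv_neq0[z yz]; exists (dotv x z / dotv y z).
have /esym/eqP := crossv_cross z x y; rewrite xy crossv0r.
rewrite subr_eq0 => /eqP e; apply: (scalerI yz).
by rewrite scalerA mulrCA divff // mulr1 dotvC e dotvC.
Qed.

Lemma orth2_parallel x y z : crossv x y != 0 -> dotv z x = 0 -> dotv z y = 0 ->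
  exists c, z = c *: crossv x y.
Proof.
move=> xy zx zy; apply: crossv_eq0 => //.
by rewrite crossv_cross zx zy !scale0r subr0.
Qed.

Lemma span2_orth x y z : crossv x y != 0 -> dotv (crossv x y) z = 0 ->
  exists a b, z = a *: x + b *: y.
Proof.
move=> /ex_dotv_neq0[w xyw] xyz.
have D0 : det3v x y w != 0 by [].
exists (det3v z y w / det3v x y w), (det3v x z w / det3v x y w).
apply: (scalerI D0); rewrite det3vE {3}/det3v xyz scale0r addr0 scalerDr !scalerA.
by rewrite ![det3v x y w * _]mulrC !divfK.
Qed.

Lemma crossv_crossl x y z : crossv (crossv x y) (crossv x z) = det3v x y z *: x.
Proof. vec_ring. Qed.

Lemma ex_det3v_neq0 x : x != 0 -> exists y z, det3v x y z != 0.
Proof.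
case/rV3_neq0; apply: ord3P => xi.
- by exists (delta_mx 0 o1), (delta_mx 0 o2);
    rewrite /det3v dotv_delta crossv2 !mxE /= mulr0 mulr1 subr0.
- by exists (delta_mx 0 o2), (delta_mx 0 o0);
    rewrite /det3v dotv_delta crossv0 !mxE /= mulr0 mulr1 subr0.
- by exists (delta_mx 0 o0), (delta_mx 0 o1);
    rewrite /det3v dotv_delta crossv1 !mxE /= mulr0 mulr1 subr0.
Qed.

Lemma ex_plane_basis x : x != 0 -> exists y z, crossv y z != 0 /\
  exists2 c, c != 0 & crossv y z = c *: x.
Proof.
move=> x0; have [y [z xyz]] := ex_det3v_neq0 x0.
exists (crossv x y), (crossv x z); rewrite crossv_crossl.
by split; [rewrite scaler_eq0 negb_or xyz | exists (det3v x y z)].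
Qed.
End VectorField.

(** * Cubic maps and their polars *)

Section TrilinearForms.
Variable R : comNzRingType.
Implicit Types (c : 'I_3 -> 'I_3 -> 'I_3 -> R) (x y z : 'rV[R]_3).

(** Homogeneous cubics are represented by the coefficients of a trilinear form
    restricted to the diagonal: the same expression makes sense over the base
    field, over polynomials in one variable (points moving on a line), and over
    polynomials in three variables (coordinates of rational maps). *)
Definition trilin c x y z : R :=
  \sum_i x 0 i * (\sum_j y 0 j * (\sum_k z 0 k * c i j k)).

(** The derivative of the cubic at [x] in the direction [y]. *)
Definition polar c x y := trilin c x x y + trilin c x y x + trilin c y x x.

Lemma trilin1 c a b x x' y z :
  trilin c (a *: x + b *: x') y z = a * trilin c x y z + b * trilin c x' y z.
Proof.
rewrite !mulr_sumr -big_split; apply: eq_bigr => i _.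
by rewrite !mxE mulrDl !mulrA.
Qed.

Lemma trilin2 c a b x y y' z :
  trilin c x (a *: y + b *: y') z = a * trilin c x y z + b * trilin c x y' z.
Proof.
rewrite !mulr_sumr -big_split; apply: eq_bigr => i _ /=.
rewrite mulrCA [b * _]mulrCA -mulrDr; congr (_ * _).
rewrite !mulr_sumr -big_split; apply: eq_bigr => j _ /=.
by rewrite !mxE mulrDl !mulrA.
Qed.

Lemma trilin3 c a b x y z z' :
  trilin c x y (a *: z + b *: z') = a * trilin c x y z + b * trilin c x y z'.
Proof.
rewrite !mulr_sumr -big_split; apply: eq_bigr => i _ /=.
rewrite mulrCA [b * _]mulrCA -mulrDr; congr (_ * _).
rewrite !mulr_sumr -big_split; apply: eq_bigr => j _ /=.
rewrite mulrCA [b * _]mulrCA -mulrDr; congr (_ * _).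
rewrite !mulr_sumr -big_split; apply: eq_bigr => k _ /=.
by rewrite !mxE mulrDl !mulrA.
Qed.

Lemma trilin_cubic c s t x y (u := s *: x + t *: y) :
  trilin c u u u = s ^+ 3 * trilin c x x x + s ^+ 2 * t * polar c x y
                   + s * t ^+ 2 * polar c y x + t ^+ 3 * trilin c y y y.
Proof. rewrite /u /polar !(trilin1, trilin2, trilin3); ring. Qed.

Lemma polarZr c s x y : polar c x (s *: y) = s * polar c x y.
Proof.
have -> : s *: y = s *: y + 0 *: y by rewrite scale0r addr0.
by rewrite /polar trilin1 trilin2 trilin3; ring.
Qed.
End TrilinearForms.

Section CubicMaps.
Variable R : comNzRingType.
Implicit Types (c : 'I_3 -> 'I_3 -> 'I_3 -> 'I_3 -> R) (x y z : 'rV[R]_3).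

Definition cubic_map c x : 'rV[R]_3 := \row_l trilin (c l) x x x.
Definition cubic_polar c x y : 'rV[R]_3 := \row_l polar (c l) x y.

Lemma cubic_map_comb c s t x y :
  cubic_map c (s *: x + t *: y) =
    s ^+ 3 *: cubic_map c x + (s ^+ 2 * t) *: cubic_polar c x y
    + (s * t ^+ 2) *: cubic_polar c y x + t ^+ 3 *: cubic_map c y.
Proof. by apply/rowP => l; rewrite !mxE trilin_cubic. Qed.

Lemma cubic_mapZ c s x : cubic_map c (s *: x) = s ^+ 3 *: cubic_map c x.
Proof.
have := cubic_map_comb c s 0 x 0.
by rewrite !scale0r addr0 !expr0n /= !(mulr0, scale0r, addr0).
Qed.

Lemma cubic_polarZr c s x y : cubic_polar c x (s *: y) = s *: cubic_polar c x y.
Proof. by apply/rowP => l; rewrite !mxE polarZr. Qed.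
End CubicMaps.

Section Morphisms.
Variables (R S : comNzRingType) (f : {rmorphism R -> S}).
Implicit Types (x y z : 'rV[R]_3).
Local Notation "x ^f" := (map_mx f x) : ring_scope.

Lemma rmorph_dotv x y : f (dotv x y) = dotv x^f y^f.
Proof. by rewrite rmorph_sum; apply: eq_bigr => i _; rewrite rmorphM !mxE. Qed.

Lemma map_crossv x y : (crossv x y)^f = crossv x^f y^f.
Proof. by apply/rowP => i; rewrite !mxE rmorphB !rmorphM. Qed.

Lemma rmorph_trilin (b : 'I_3 -> 'I_3 -> 'I_3 -> R)
    (b' : 'I_3 -> 'I_3 -> 'I_3 -> S) x y z :
  (forall i j k, f (b i j k) = b' i j k) ->
  f (trilin b x y z) = trilin b' x^f y^f z^f.
Proof.
move=> fb; rewrite rmorph_sum; apply: eq_bigr => i _; rewrite rmorphM !mxE rmorph_sum.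
congr (_ * _); apply: eq_bigr => j _; rewrite rmorphM !mxE rmorph_sum.
by congr (_ * _); apply: eq_bigr => k _; rewrite rmorphM !mxE fb.
Qed.

Variables (c : 'I_3 -> 'I_3 -> 'I_3 -> 'I_3 -> R).
Variables (c' : 'I_3 -> 'I_3 -> 'I_3 -> 'I_3 -> S).
Hypothesis fc : forall l i j k, f (c l i j k) = c' l i j k.

Lemma map_cubic_map x : (cubic_map c x)^f = cubic_map c' x^f.
Proof. by apply/rowP => l; rewrite !mxE (rmorph_trilin _ _ _ (fc l)). Qed.

Lemma map_cubic_polar x y : (cubic_polar c x y)^f = cubic_polar c' x^f y^f.
Proof.
by apply/rowP => l; rewrite !mxE !rmorphD !(rmorph_trilin _ _ _ (fc l)).
Qed.
End Morphisms.

Section Homogeneous.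
Variables (n : nat) (R : comNzRingType).
Implicit Types (f g : {mpoly R[n]}).

(** Each monomial of positive degree is divisible by one of its variables. *)
Lemma dhomog_lead_var d f : f \is d.+1.-homog ->
  exists2 g : 'I_n -> {mpoly R[n]},
    forall i, g i \is d.-homog & f = \sum_i 'X_i * g i.
Proof.
pose P (f : {mpoly R[n]}) := exists2 g : 'I_n -> {mpoly R[n]},
    forall i, g i \is d.-homog & f = \sum_i 'X_i * g i.
have P0 : P 0.
  exists (fun=> 0) => [i|]; first exact: rpred0.
  by rewrite big1 // => i _; rewrite mulr0.
have PD f1 f2 : P f1 -> P f2 -> P (f1 + f2).
  move=> [g1 h1 ->] [g2 h2 ->]; exists (fun i => g1 i + g2 i) => [i|].
    exact: rpredD.
  by rewrite -big_split; apply: eq_bigr => i _; rewrite mulrDr.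
move=> /dhomogP hf; rewrite [f]mpolyE big_seq -/(P _); apply: big_ind => //.
move=> m /hf m_deg; have dm : mdeg m = d.+1 by exact: m_deg.
have : m != 0%MM by rewrite -mdeg_eq0 dm.
have [i mi] : exists i, (0 < m i)%N.
  apply/existsP; apply: contra_eqT dm; rewrite negb_exists => /forallP m0.
  by rewrite mdegE big1 // => i _; apply/eqP; rewrite -leqn0 leqNgt.
move=> _; have le : (U_(i) <= m)%MM.
  by apply/mnm_lepP => j; rewrite mnm1E; case: eqP => [<-|].
exists (fun j => if j == i then f@_m *: 'X_[m - U_(i)] else 0) => [j|].
  case: eqP => _; last exact: rpred0.
  apply: rpredZ; rewrite dhomogX -(eqn_add2r (mdeg U_(i))) -mdegD submK //.
  by rewrite dm mdeg1 addn1.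
rewrite (bigD1 i) //= eqxx big1 => [|j /negbTE->]; last by rewrite mulr0.
by rewrite addr0 -scalerAr -mpolyXD addmC submK.
Qed.

Lemma dhomog_const f : f \is 0.-homog -> exists a, f = a%:MP.
Proof.
move=> /dhomogP hf; exists f@_0%MM; apply/mpolyP => m; rewrite mcoeffC.
have [->|m0] := eqVneq m 0%MM; first by rewrite mulr1.
rewrite mulr0; apply: memN_msupp_eq0; apply: contra m0 => /hf m_deg.
by rewrite -mdeg_eq0; apply/eqP; exact: m_deg.
Qed.
End Homogeneous.

Definition varv (R : nzRingType) : 'rV[{mpoly R[3]}]_3 := \row_i 'X_i.

Lemma dhomog3_trilin (R : comNzRingType) (f : {mpoly R[3]}) : f \is 3.-homog ->
  exists c, f = trilin (fun i j k => (c i j k)%:MP) (varv R) (varv R) (varv R).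
Proof.
have lin (g : {mpoly R[3]}) : g \is 1.-homog ->
    exists c : 'I_3 -> R, g = \sum_i 'X_i * (c i)%:MP.
  move=> /dhomog_lead_var[g1 h1 ->].
  have /fin_all_exists[c e] i := dhomog_const (h1 i).
  by exists c; apply: eq_bigr => i _; rewrite e.
have quad (g : {mpoly R[3]}) : g \is 2.-homog ->
    exists c : 'I_3 -> 'I_3 -> R,
      g = \sum_i 'X_i * \sum_j 'X_j * (c i j)%:MP.
  move=> /dhomog_lead_var[g1 h1 ->].
  have /fin_all_exists[c e] i := lin _ (h1 i).
  by exists c; apply: eq_bigr => i _; rewrite e.
move=> /dhomog_lead_var[g1 h1 ->].
have /fin_all_exists[c e] i := quad _ (h1 i).
exists c; apply: eq_bigr => i _; rewrite e mxE; congr (_ * _).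
apply: eq_bigr => j _; rewrite mxE; congr (_ * _).
by apply: eq_bigr => k _; rewrite mxE.
Qed.

Lemma meval_varv (R : comNzRingType) (x : 'rV[R]_3) :
  map_mx (meval (x 0)) (varv R) = x.
Proof. by apply/rowP => i; rewrite !mxE mevalXU. Qed.

(** * Tangency points on a line *)

(** The second pair is taken so that the two zeros are distinct points of the
    projective line as soon as the discriminant does not vanish. *)
Lemma binary_quadratic_roots (K : numClosedFieldType) (a b g : K) :
  exists s0 t0 s1 t1 : K,
    [/\ a * s0 ^+ 2 + b * (s0 * t0) + g * t0 ^+ 2 = 0,
        a * s1 ^+ 2 + b * (s1 * t1) + g * t1 ^+ 2 = 0,
        (s0 != 0) || (t0 != 0)
      & b ^+ 2 - 4 * (a * g) != 0 -> s0 * t1 - t0 * s1 != 0].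
Proof.
have [->|a0] := eqVneq a 0.
  exists 1, 0, g, (- b); split; [ring | ring | by rewrite oner_neq0 |].
  by rewrite !(mul0r, mulr0, subr0, mul1r) sqrf_eq0 oppr_eq0.
pose r := sqrtC (b ^+ 2 - 4 * (a * g)).
have r2 : r ^+ 2 = b ^+ 2 - 4 * (a * g) by rewrite sqrtCK.
exists (- b + r), (2 * a), (- b - r), (2 * a); split.
- have -> : a * (- b + r) ^+ 2 + b * ((- b + r) * (2 * a)) + g * (2 * a) ^+ 2
    = a * (r ^+ 2 - (b ^+ 2 - 4 * (a * g))) by ring.
  by rewrite r2 subrr mulr0.
- have -> : a * (- b - r) ^+ 2 + b * ((- b - r) * (2 * a)) + g * (2 * a) ^+ 2
    = a * (r ^+ 2 - (b ^+ 2 - 4 * (a * g))) by ring.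
  by rewrite r2 subrr mulr0.
- by rewrite mulf_neq0 ?pnatr_eq0 ?orbT.
- rewrite -r2 sqrf_eq0 => r0.
  have -> : (- b + r) * (2 * a) - 2 * a * (- b - r) = 4 * (a * r) by ring.
  by rewrite !mulf_neq0 ?pnatr_eq0.
Qed.

(** The discriminant of [tangency_form] below. *)
Definition tangency_disc (R : comNzRingType)
    (c : 'I_3 -> 'I_3 -> 'I_3 -> 'I_3 -> R) (x y : 'rV[R]_3) : R :=
  dotv y (cubic_polar c x y) ^+ 2
  + 4 * (dotv y (cubic_map c x) * dotv x (cubic_map c y)).

Section Involution.
Variables (R : comNzRingType) (c : 'I_3 -> 'I_3 -> 'I_3 -> 'I_3 -> R).
Variable e : 'rV[R]_3.
Implicit Type m : 'rV[R]_3.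

(** The tangent line at [m] meets the fixed line [e] in this point, so that the
    two points span the tangent line when [m] is not on [e]. *)
Definition tangent_dir m := crossv (cubic_map c m) e.

(** On the line spanned by [m] and [tangent_dir m] the tangency form is
    [tangency_st m * (s * t) + tangency_tt m * t ^+ 2]; the zero other than [m]
    is [second_root m]. *)
Definition tangency_st m := dotv (tangent_dir m) (cubic_polar c m (tangent_dir m)).
Definition tangency_tt m := - dotv m (cubic_map c (tangent_dir m)).
Definition second_root m := tangency_tt m *: m - tangency_st m *: tangent_dir m.
End Involution.

Section MorphismsInvolution.
Variables (R S : comNzRingType) (f : {rmorphism R -> S}).
Variables (c : 'I_3 -> 'I_3 -> 'I_3 -> 'I_3 -> R).
Variables (c' : 'I_3 -> 'I_3 -> 'I_3 -> 'I_3 -> S).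
Hypothesis fc : forall l i j k, f (c l i j k) = c' l i j k.
Implicit Types (x y e : 'rV[R]_3).
Local Notation "x ^f" := (map_mx f x) : ring_scope.

Lemma rmorph_tangency_disc x y : f (tangency_disc c x y) = tangency_disc c' x^f y^f.
Proof.
rewrite rmorphD rmorphXn !rmorphM rmorph_nat !rmorph_dotv.
by rewrite !(map_cubic_map fc, map_cubic_polar fc).
Qed.

Lemma map_tangent_dir e x : (tangent_dir c e x)^f = tangent_dir c' e^f x^f.
Proof. by rewrite map_crossv (map_cubic_map fc). Qed.

Lemma rmorph_tangency_st e x : f (tangency_st c e x) = tangency_st c' e^f x^f.
Proof. by rewrite rmorph_dotv (map_cubic_polar fc) map_tangent_dir. Qed.

Lemma rmorph_tangency_tt e x : f (tangency_tt c e x) = tangency_tt c' e^f x^f.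
Proof. by rewrite rmorphN rmorph_dotv (map_cubic_map fc) map_tangent_dir. Qed.

Lemma map_second_root e x : (second_root c e x)^f = second_root c' e^f x^f.
Proof.
by rewrite map_mxB !map_mxZ map_tangent_dir rmorph_tangency_st rmorph_tangency_tt.
Qed.
End MorphismsInvolution.

Section Tangency.
Variables (K : numClosedFieldType).
Variables (c : 'I_3 -> 'I_3 -> 'I_3 -> 'I_3 -> K).
Hypothesis euler : forall x, dotv x (cubic_map c x) = 0.
Implicit Types (x y m q : 'rV[K]_3) (s t : K).
Local Notation F := (cubic_map c).
Local Notation D := (cubic_polar c).

(** These are two coefficients, in s and t, of the Euler relation at
    s x + t y. They are extracted from its values at (1, 1), (1, -1), (1, 2). *)
Lemma euler_polar x y :
  dotv x (D x y) = - dotv y (F x) /\ dotv x (D y x) = - dotv y (D x y).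
Proof.
pose e1 := dotv x (D x y) + dotv y (F x).
pose e2 := dotv x (D y x) + dotv y (D x y).
pose e3 := dotv x (F y) + dotv y (D y x).
have E s t : s ^+ 3 * t * e1 + s ^+ 2 * t ^+ 2 * e2 + s * t ^+ 3 * e3 = 0.
  have := euler (s *: x + t *: y); rewrite cubic_map_comb.
  rewrite !(dotvDl, dotvDr, dotvZl, dotvZr) !euler => E0.
  by apply: etrans E0; rewrite /e1 /e2 /e3; ring.
have := E 1 1; have := E 1 (-1); have := E 1 2.
have e20 : e2 = 0.
  have : 2 * e2 = 0 by rewrite -[RHS](addr0 0) -{1}(E 1 1) -(E 1 (-1)); ring.
  by move/eqP; rewrite mulf_eq0 pnatr_eq0 /= => /eqP.
have e10 : e1 = 0.
  have : 6 * e1 = 0.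
    rewrite -[RHS](_ : 8 * 0 - 0 = 0); last by ring.
    by rewrite -{1}(E 1 1) -(E 1 2) e20; ring.
  by move/eqP; rewrite mulf_eq0 pnatr_eq0 /= => /eqP.
by move=> _ _ _; split; apply/eqP; rewrite -addr_eq0; apply/eqP.
Qed.

(** The binary quadratic form whose zeros are the tangency points on the line
    through [x] and [y]; see [tangency_form_r] and [tangency_form_l]. *)
Definition tangency_form x y s t :=
  dotv y (F x) * s ^+ 2 + dotv y (D x y) * (s * t) - dotv x (F y) * t ^+ 2.

Lemma tangency_form_r x y s t :
  dotv (F (s *: x + t *: y)) y = s * tangency_form x y s t.
Proof.
have [e1 e2] := euler_polar y x.
rewrite cubic_map_comb !(dotvDl, dotvZl) ![dotv _ y]dotvC euler e1 /tangency_form; ring.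
Qed.

Lemma tangency_form_l x y s t :
  dotv (F (s *: x + t *: y)) x = - (t * tangency_form x y s t).
Proof.
have [e1 e2] := euler_polar x y.
rewrite cubic_map_comb !(dotvDl, dotvZl) ![dotv _ x]dotvC euler e1 e2.
by rewrite /tangency_form; ring.
Qed.

(** F(q) is a multiple of the line through [x] and [y] when it is orthogonal to
    both points. At q = s x + t y this means that s Q(s, t) and t Q(s, t) vanish,
    that is Q(s, t) = 0, because s and t are not both zero. *)
Lemma tangency_form_eq0P x y s t : crossv x y != 0 -> (s != 0) || (t != 0) ->
  tangency_form x y s t = 0 <-> exists k, F (s *: x + t *: y) = k *: crossv x y.
Proof.
move=> xy st; split=> [Q0|[k Fk]].
  by apply: orth2_parallel; rewrite // (tangency_form_l, tangency_form_r) Q0 mulr0 ?oppr0.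
have := tangency_form_l x y s t; have := tangency_form_r x y s t.
rewrite Fk !dotvZl dotv_crossl dotv_crossr mulr0 => /esym/eqP.
rewrite mulf_eq0 => /orP[/eqP s0|/eqP //] /esym/eqP; rewrite oppr_eq0 mulf_eq0.
by case/orP => /eqP // t0; rewrite s0 t0 eqxx in st.
Qed.

Lemma comb_neq0 x y s t : crossv x y != 0 -> (s != 0) || (t != 0) ->
  s *: x + t *: y != 0.
Proof.
move=> xy; apply: contraTneq => st0.
have Z u v : (s * v - t * u) *: crossv x y = 0.
  by rewrite -crossv_comb st0; vec_ring.
have := Z 1 0; have := Z 0 1; rewrite mulr1 mulr0 subr0 mulr0 mulr1 sub0r.
move/eqP; rewrite scaler_eq0 (negbTE xy) orbF => /eqP -> /eqP.
by rewrite scaler_eq0 (negbTE xy) orbF oppr_eq0 => /eqP ->; rewrite eqxx.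
Qed.

Lemma dotv_cross_comb x y s t : dotv (crossv x y) (s *: x + t *: y) = 0.
Proof. by rewrite dotvDr !dotvZr dotv_crossl dotv_crossr !mulr0 addr0. Qed.

Lemma exists_tangency x y : crossv x y != 0 ->
  exists m, [/\ m != 0, dotv (crossv x y) m = 0 & exists k, F m = k *: crossv x y].
Proof.
move=> xy.
have [s [t [_ [_ [Q0 _ st _]]]]] :=
  binary_quadratic_roots (dotv y (F x)) (dotv y (D x y)) (- dotv x (F y)).
exists (s *: x + t *: y); split; first exact: comb_neq0.
  exact: dotv_cross_comb.
by apply/tangency_form_eq0P => //; rewrite /tangency_form -Q0 mulNr.
Qed.

(** The point [q] records that the line is not everywhere tangent to the
    foliation. *)
Lemma two_tangencies x y : crossv x y != 0 -> tangency_disc c x y != 0 ->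
  exists m0 m1, [/\ crossv m0 m1 != 0,
    dotv (crossv x y) m0 = 0 /\ dotv (crossv x y) m1 = 0,
    exists k, F m0 = k *: crossv x y & exists k, F m1 = k *: crossv x y]
  /\ exists q, dotv (crossv x y) q = 0 /\ ~ exists k, F q = k *: crossv x y.
Proof.
move=> xy disc.
have [s0 [t0 [s1 [t1 [Q0 Q1 st0 det]]]]] :=
  binary_quadratic_roots (dotv y (F x)) (dotv y (D x y)) (- dotv x (F y)).
have {}det : s0 * t1 - t0 * s1 != 0 by apply: det; rewrite !mulrN opprK.
have st1 : (s1 != 0) || (t1 != 0).
  by apply: contraNT det; rewrite negb_or !negbK => /andP[/eqP-> /eqP->];
    rewrite !mulr0 subr0.
exists (s0 *: x + t0 *: y), (s1 *: x + t1 *: y); split.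
  split; first by rewrite crossv_comb scaler_eq0 negb_or det.
  - by rewrite !dotv_cross_comb.
  - by apply/tangency_form_eq0P => //; rewrite /tangency_form -Q0 mulNr.
  - by apply/tangency_form_eq0P => //; rewrite /tangency_form -Q1 mulNr.
have [s [t [st Q]]] : exists s t, (s != 0) || (t != 0) /\ tangency_form x y s t != 0.
  (* a form vanishing at (1, 0), (0, 1) and (1, 1) would be zero *)
  have [a0|a0] := eqVneq (dotv y (F x)) 0; last first.
    exists 1, 0; rewrite oner_neq0; split=> //.
    by rewrite /tangency_form expr1n expr0n !(mulr0, mulr1, addr0, subr0).
  have [g0|g0] := eqVneq (dotv x (F y)) 0; last first.
    exists 0, 1; rewrite oner_neq0 orbT; split=> //.
    by rewrite /tangency_form expr1n expr0n
      !(mul0r, mulr0, mulr1, add0r, sub0r) oppr_eq0.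
  exists 1, 1; rewrite oner_neq0; split=> //.
  move: disc; rewrite /tangency_disc /tangency_form a0 g0.
  rewrite !(mul0r, mulr0, addr0, add0r, subr0).
  by rewrite sqrf_eq0 !mulr1.
exists (s *: x + t *: y); rewrite dotv_cross_comb; split=> //.
by move/tangency_form_eq0P => Qz; rewrite Qz ?eqxx in Q.
Qed.

Section Map.
Variable e : 'rV[K]_3.
Local Notation d := (tangent_dir c e).
Local Notation A := (tangency_st c e).
Local Notation B := (tangency_tt c e).
Local Notation I := (second_root c e).

Lemma second_rootE m : I m = B m *: m + (- A m) *: d m.
Proof. by rewrite [(- A m) *: _]scaleNr. Qed.

Lemma dotv_tangent_dir m : dotv (d m) (F m) = 0.
Proof. exact: dotv_crossl. Qed.

Lemma crossv_tangent_dir m : crossv m (d m) = dotv m e *: F m.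
Proof. by rewrite crossv_cross euler scale0r subr0. Qed.

Lemma tangency_form_tangent m s t :
  tangency_form m (d m) s t = t * (A m * s + B m * t).
Proof. by rewrite /tangency_form dotv_tangent_dir /tangency_st /tangency_tt; ring. Qed.

Lemma dotv_tangent_dir_e m : dotv (d m) e = 0.
Proof. exact: dotv_crossr. Qed.

Lemma dotv_second_root_e m : dotv (I m) e = B m * dotv m e.
Proof.
rewrite second_rootE.
by rewrite dotvDl !dotvZl dotv_tangent_dir_e mulr0 addr0.
Qed.

Lemma tangency_on_tangent m s t : F m != 0 -> dotv m e != 0 ->
  (s != 0) || (t != 0) ->
  t * (A m * s + B m * t) = 0 <-> exists k, F (s *: m + t *: d m) = k *: F m.
Proof.
move=> Fm me st; have xy : crossv m (d m) != 0.
  by rewrite crossv_tangent_dir scaler_eq0 negb_or me.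
rewrite -tangency_form_tangent; apply: (iff_trans (tangency_form_eq0P xy st)).
rewrite crossv_tangent_dir.
split=> -[k ->]; first by exists (k * dotv m e); rewrite scalerA.
by exists (k / dotv m e); rewrite scalerA divfK.
Qed.

Lemma on_tangent_line m q : F m != 0 -> dotv m e != 0 -> dotv (F m) q = 0 ->
  exists s t, q = s *: m + t *: d m.
Proof.
move=> Fm me Fq; apply: span2_orth.
  by rewrite crossv_tangent_dir scaler_eq0 negb_or me.
by rewrite crossv_tangent_dir dotvZl Fq mulr0.
Qed.

Lemma second_rootP m q : F m != 0 -> dotv m e != 0 -> A m != 0 ->
  q != 0 -> dotv (F m) q = 0 ->
  (exists k, F q = k *: F m) <-> (q == m)%MS \/ (q == I m)%MS.
Proof.
move=> Fm me Am q0 /on_tangent_line[//|//|s [t qE]].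
have st : (s != 0) || (t != 0).
  by apply: contraNT q0; rewrite negb_or !negbK qE => /andP[/eqP-> /eqP->];
    rewrite !scale0r addr0.
rewrite qE; apply: (iff_trans (iff_sym (tangency_on_tangent Fm me st))).
split=> [/eqP|[]/row_eqmxP[k k0]]; rewrite ?mulf_eq0.
- have [t0 _|t0 /= /eqP AB] := eqVneq t 0.
    left; apply/row_eqmxP; exists s; last by rewrite t0 scale0r addr0.
    by move: st; rewrite t0 eqxx orbF.
  right; apply/row_eqmxP; exists (- t / A m).
    by rewrite mulf_neq0 ?invr_eq0 ?oppr_eq0.
  have -> : s = - t / A m * B m.
    by apply: (mulfI Am); rewrite -(addrK (B m * t) (A m * s)) AB; field.
  by rewrite /second_root scalerBr !scalerA divfK // scaleNr opprK.
- move=> qm; have := crossv_comb s t 1 0 m (d m).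
  rewrite qm scale1r scale0r addr0 crossvZl crossvv scaler0 crossv_tangent_dir.
  rewrite mulr0 mulr1 sub0r => /esym/eqP.
  rewrite !scaler_eq0 (negbTE me) (negbTE Fm) !orbF oppr_eq0 => /eqP ->.
  by rewrite mul0r.
- move=> qm; have := crossv_comb s t (B m) (- A m) m (d m).
  rewrite qm -second_rootE crossvZl crossvv scaler0 crossv_tangent_dir.
  move/esym/eqP; rewrite !scaler_eq0 (negbTE me) (negbTE Fm) !orbF => /eqP AB.
  have -> : A m * s + B m * t = - (s * - A m - t * B m) by ring.
  by rewrite AB oppr0 mulr0.
Qed.

Lemma crossv_second_root_neq0 m : F m != 0 -> dotv m e != 0 -> A m != 0 ->
  crossv (I m) m != 0.
Proof.
move=> Fm me Am; have := crossv_comb (B m) (- A m) 1 0 m (d m).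
rewrite -second_rootE scale1r scale0r addr0 => ->.
by rewrite crossv_tangent_dir !scaler_eq0 mulr0 mulr1 sub0r opprK !negb_or Am me.
Qed.

Lemma dotv_tangent_second_root m : dotv (F m) (I m) = 0.
Proof.
rewrite second_rootE.
by rewrite dotvDr !dotvZr ![dotv (F m) _]dotvC euler dotv_tangent_dir !mulr0 addr0.
Qed.

(** The tangent lines at m and at m' = [second_root m] coincide, so m is a zero,
    other than m', of the tangency form relative to m' and its direction. This
    determines the ratio of the two coefficients of that form, hence
    [second_root m'] up to a factor, which is made explicit to see that it does
    not vanish. *)
Lemma second_root_involutive m k : F (I m) = k *: F m ->
  A m != 0 -> I (I m) = (k * B m) ^+ 3 *: m.
Proof.
move=> FI Am; set m' := I m.
have mE : B m *: m = 1 *: m' + A m *: d m by rewrite scale1r subrK.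
have dE : d m' = k *: d m by rewrite /tangent_dir FI crossvZl.
(* [b] and [g] are the coefficients of the tangency form at m', up to powers of k *)
pose b := dotv (d m) (D m' (d m)); pose g := - dotv m' (F (d m)).
have gE : g = B m ^+ 2.
  rewrite /g /m'.
  rewrite second_rootE.
  by rewrite dotvDl !dotvZl euler mulr0 addr0 /tangency_tt; ring.
have bE : b = - (g * A m).
  have := tangency_form_r m' (d m) 1 (A m).
  rewrite -mE cubic_mapZ dotvZl [dotv (F m) _]dotvC dotv_tangent_dir mulr0 mul1r.
  rewrite /tangency_form FI dotvZr dotv_tangent_dir.
  rewrite !(mulr0, mul0r, mul1r, add0r) => /esym E.
  apply: (mulfI Am); apply/eqP; rewrite -subr_eq0; apply/eqP.
  by apply: etrans E; rewrite /b /g; ring.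
have AE : A m' = k ^+ 2 * b by rewrite /tangency_st dE cubic_polarZr dotvZl dotvZr mulrA.
have BE : B m' = k ^+ 3 * g by rewrite /tangency_tt dE cubic_mapZ dotvZr mulrN.
rewrite {1}/second_root AE BE dE bE.
have -> : (k ^+ 3 * g) *: m' - (k ^+ 2 * - (g * A m)) *: (k *: d m) =
  (k ^+ 3 * g) *: (1 *: m' + A m *: d m) by vec_ring.
by rewrite -mE scalerA gE; congr (_ *: _); ring.
Qed.

(** If one coefficient of the form t (A s + B t) vanished, so would the other,
    since the root given by [m1] has s and t nonzero: the latter because
    [m1] differs from [m0], the former because [m1] is not on the line [e].
    Then the whole line would be tangent, against [q]. *)
Lemma tangency_coefs_neq0 m0 m1 : dotv m0 e != 0 -> dotv m1 e != 0 ->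
  F m0 != 0 -> crossv m0 m1 != 0 -> dotv (F m0) m1 = 0 ->
  (exists k, F m1 = k *: F m0) ->
  (exists q, dotv (F m0) q = 0 /\ ~ exists k, F q = k *: F m0) ->
  A m0 != 0 /\ B m0 != 0.
Proof.
move=> e0 e1 F0 ind Fm1 par [q [Fq nq]].
have [s [t m1E]] := on_tangent_line F0 e0 Fm1.
have t0 : t != 0.
  by apply: contraNneq ind => t0; rewrite m1E t0 scale0r addr0 crossvZr crossvv scaler0.
have s0 : s != 0.
  apply: contraNneq e1 => s0.
  by rewrite m1E s0 scale0r add0r dotvZl dotv_tangent_dir_e mulr0.
have AB : A m0 * s = - (B m0 * t).
  apply/eqP; rewrite -addr_eq0; move: par; rewrite m1E.
  rewrite -tangency_on_tangent ?s0 // => /eqP.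
  by rewrite mulf_eq0 (negbTE t0).
suff B0 : B m0 != 0.
  by split=> //; rewrite -(mulIr_eq0 _ (mulIf s0)) AB oppr_eq0 mulf_neq0.
apply/eqP => B0; apply: nq.
have A0 : A m0 = 0.
  by apply/eqP; rewrite -(mulIr_eq0 _ (mulIf s0)) AB B0 mul0r oppr0.
have [s' [t' qE]] := on_tangent_line F0 e0 Fq; rewrite qE.
have [/orP st|] := boolP ((s' != 0) || (t' != 0)).
  by apply/tangency_on_tangent => //; [apply/orP | rewrite A0 B0; ring].
rewrite negb_or !negbK => /andP[/eqP-> /eqP->]; exists 0.
by rewrite !scale0r addr0 -[X in F X](scale0r (0 : 'rV_3)) cubic_mapZ expr0n scale0r.
Qed.

End Map.
End Tangency.

(** * Nonvanishing of polynomials *)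

Section Nonvanishing.
Variable K : numFieldType.

Lemma poly_nonroot (q : {poly K}) : q != 0 -> exists t, q.[t] != 0.
Proof.
move=> q0; pose s : seq K := [seq i%:R | i <- iota 0 (size q)].
have us : uniq s.
  by rewrite map_inj_uniq ?iota_uniq // => i j /eqP; rewrite eqr_nat => /eqP.
have [rs|/allPn[t _ qt]] := boolP (all (root q) s); last by exists t.
by have := max_poly_roots q0 rs us; rewrite size_map size_iota ltnn.
Qed.

(** Points of the curve (1, t, t^2): a nonzero linear form has finitely many
    zeros on it. *)
Lemma avoid_planes (ws : seq 'rV[K]_3) : all (fun w => w != 0) ws ->
  exists l, all (fun w => dotv l w != 0) ws.
Proof.
move=> ws0.
pose q (w : 'rV[K]_3) := Poly [:: w 0 o0; w 0 o1; w 0 o2].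
have q0 (w : 'rV[K]_3) : w != 0 -> q w != 0.
  apply: contraNneq => /polyP q0; apply/eqP/row3P; rewrite !mxE.
  - by have := q0 0%N; rewrite coef_Poly coef0.
  - by have := q0 1%N; rewrite coef_Poly coef0.
  - by have := q0 2%N; rewrite coef_Poly coef0.
have /poly_nonroot[t] : \prod_(w <- ws) q w != 0.
  by rewrite prodf_seq_neq0; apply: sub_all ws0 => w /q0.
rewrite horner_prod prodf_seq_neq0 => qt.
exists (\row_i t ^+ i); apply: sub_all qt => w /=.
rewrite horner_Poly /= dotvE !mxE /= => qt.
by apply: contraNneq qt => e; apply/eqP; apply: etrans e; ring.
Qed.

(** Kronecker substitution: the monomials of [f] remain distinct after the
    variables are replaced by t, t^N and t^(N^2), if N is large. *)
Lemma mpoly_nonvanishing (f : {mpoly K[3]}) : f != 0 ->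
  exists x : 'rV[K]_3, f.@[x 0] != 0.
Proof.
move=> f0; pose N := (msize f).+1.
pose phi (m : 'X_{1..3}) := (m o0 + (m o1 + m o2 * N) * N)%N.
pose q : {poly K} := \sum_(m <- msupp f) f@_m *: 'X^(phi m).
have lt m i : m \in msupp f -> (m i < N)%N.
  move=> /msize_mdeg_lt lm; rewrite /N ltnS; apply: leq_trans (ltnW lm).
  by rewrite mdegE (bigD1 i) //= leq_addr.
have phi_inj : {in msupp f &, injective phi}.
  move=> m m' mf mf' e; apply/mnmP.
  have N0 : (0 < N)%N by [].
  have e0 : m o0 = m' o0.
    by have := congr1 (modn^~ N) e; rewrite /phi ![(m _ + _)%N]addnC ![(m' _ + _)%N]addnC
      !modnMDl !modn_small ?lt.
  move: e; rewrite /phi e0 => /addnI/eqP; rewrite eqn_pmul2r // => /eqP e.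
  have e1 : m o1 = m' o1.
    by have := congr1 (modn^~ N) e; rewrite ![(m _ + _)%N]addnC ![(m' _ + _)%N]addnC
      !modnMDl !modn_small ?lt.
  move: e; rewrite e1 => /addnI/eqP; rewrite eqn_pmul2r // => /eqP e2.
  exact: ord3P.
have q0 : q != 0.
  apply/eqP => /polyP/(_ (phi (mlead f))); rewrite coef0 coef_sum.
  rewrite (bigD1_seq (mlead f)) ?mlead_supp ?msupp_uniq //= big_seq_cond big1.
    rewrite coefZ coefXn eqxx mulr1 addr0 => /eqP.
    by rewrite mcoeff_eq0 mlead_supp.
  move=> m /andP[mf ml]; rewrite coefZ coefXn.
  case: eqP => [/phi_inj e|]; last by rewrite mulr0.
  by rewrite e ?mlead_supp ?eqxx in ml.
have [t qt] := poly_nonroot q0.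
exists (\row_i (if i == o0 then t else if i == o1 then t ^+ N else t ^+ (N * N))).
apply: contraNneq qt => e; rewrite -[X in _ == X]e mevalE /q horner_sum; apply/eqP.
apply: eq_bigr => m _; rewrite hornerZ hornerXn; congr (_ * _).
rewrite !big_ord_recl big_ord0 !mxE /= mulr1 /phi.
rewrite -!exprM -!exprD; congr (t ^+ _).
have -> : lift ord0 (lift ord0 ord0) = o2 :> 'I_3 by exact: val_inj.
have -> : lift ord0 ord0 = o1 :> 'I_3 by exact: val_inj.
have -> : ord0 = o0 :> 'I_3 by exact: val_inj.
by ring.
Qed.
End Nonvanishing.

(** * Curves through points in general position *)

Section LinearForms.
Variable K : fieldType.
Implicit Types (n x : 'rV[K]_3).

Definition linform n : {mpoly K[3]} :=
  dotv (map_mx (@mpolyC 3 K) n) (varv K).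

Lemma meval_linform n x : (linform n).@[x 0] = dotv n x.
Proof.
rewrite /linform rmorph_dotv meval_varv; congr dotv.
by apply/rowP => i; rewrite !mxE; exact: mevalC.
Qed.

Lemma dhomog_mulC d (a : K) (f : {mpoly K[3]}) :
  f \is d.-homog -> a%:MP * f \is d.-homog.
Proof. by move=> hf; rewrite mul_mpolyC rpredZ. Qed.

Lemma linform_homog n : linform n \is 1.-homog.
Proof.
apply: rpred_sum => i _; rewrite !mxE; apply: dhomog_mulC.
by rewrite dhomogX; apply/eqP; exact: mdeg1.
Qed.

(** Stated for arbitrary polynomials, to evaluate a pencil of conics without
    unfolding the linear forms that generate it. *)
Lemma meval_pencil (z : 'I_3 -> K) s r (f f' g g' : {mpoly K[3]}) :
  (s%:MP * (f * f') - r%:MP * (g * g')).@[z]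
    = s * (f.@[z] * f'.@[z]) - r * (g.@[z] * g'.@[z]).
Proof. by rewrite mevalB !mevalM !mevalC. Qed.
End LinearForms.

Ltac distinct_from U :=
  move: U; rewrite /= !inE !negb_or !andbT;
  repeat first [case/andP | move=> ?];
  repeat (apply/andP; split);
  first [by [] | by rewrite eq_sym].

Section SamePoint.
Variable K : fieldType.

Lemma same_point_refl (q : point K) : same_point q q.
Proof. by apply/andP. Qed.

Lemma same_point_sym (x y : point K) : same_point x y = same_point y x.
Proof. exact: andbC. Qed.

Lemma same_point_trans (x y z : point K) :
  same_point x y -> same_point y z -> same_point x z.
Proof.
move=> /andP[xy yx] /andP[yz zy].
by apply/andP; split; [exact: submx_trans xy yz | exact: submx_trans zy yx].
Qed.
End SamePoint.

Section GeneralPosition.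
Variables (K : numClosedFieldType) (p : 'I_7 -> point K).
Hypothesis gp : general_position p.
Local Notation v i := (val (p i)).
Local Notation det i j k := (det3v (v i) (v j) (v k)).

(** If the determinant vanished, a line would contain the three points: the one
    through [i] and [j], or, when these two coincide, the one through [j] and
    [k], or, when all three coincide, any line through [k]. *)
Lemma noncollinear i j k : uniq [:: i; j; k] -> det i j k != 0.
Proof.
move=> ijk; apply/eqP => D0.
have sub (n : 'rV[K]_3) : n != 0 -> dotv n (v i) = 0 -> dotv n (v j) = 0 ->
    dotv n (v k) = 0 -> False.
  move=> n0 ni nj nk; have A3 : #|[set x in [:: i; j; k]]| = 3%N.
    by rewrite cardsE (card_uniqP ijk).
  apply: gp.1 A3 _; exists (linform n); split; last 1 first.
  - move=> l; rewrite !inE /evalpt meval_linform.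
    by case/or3P => /eqP ->.
  - case: (ex_dotv_neq0 n0) => x; apply: contraNneq => f0.
    by rewrite -meval_linform f0 meval0.
  - exact: linform_homog.
have [xy|xy] := eqVneq (crossv (v i) (v j)) 0; last first.
  by apply: sub xy _ _ D0; rewrite ?dotv_crossl ?dotv_crossr.
have [a ij] := crossv_eq0 xy (valP (p j)).
have [xz|xz] := eqVneq (crossv (v j) (v k)) 0; last first.
  apply: sub xz _ _ _; rewrite ?dotv_crossl ?dotv_crossr //.
  by rewrite ij dotvZr dotv_crossl mulr0.
have [b jk] := crossv_eq0 xz (valP (p k)).
have [x kx] := ex_det3v_neq0 (valP (p k)); case: kx => y kxy.
have kx : crossv (v k) x != 0.
  by apply: contraNneq kxy; rewrite /det3v => ->; rewrite dotv0l.
by apply: sub kx _ _ _; rewrite ?ij ?jk ?dotvZr dotv_crossl ?mulr0.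
Qed.

Lemma ord7_shift (i j : 'I_7) : j != i ->
  [\/ j = i + 1 \/ j = i + 2%:R, j = i + 3%:R \/ j = i + 4%:R
     | j = i + 5%:R \/ j = i + 6%:R].
Proof.
move: i j => [[|[|[|[|[|[|[|//]]]]]]] hi] [[|[|[|[|[|[|[|//]]]]]]] hj] //= _;
by [ constructor 1; left; apply: val_inj
   | constructor 1; right; apply: val_inj
   | constructor 2; left; apply: val_inj
   | constructor 2; right; apply: val_inj
   | constructor 3; left; apply: val_inj
   | constructor 3; right; apply: val_inj ].
Qed.

Lemma uniq_shift (i a b : 'I_7) : uniq [:: a; b; 0] -> uniq [:: i + a; i + b; i].
Proof.
have -> : [:: i + a; i + b; i] = map (+%R i) [:: a; b; 0] by rewrite /= addr0.
by rewrite map_inj_uniq //; exact: addrI.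
Qed.

(** Three lines, each through two of the other six points; the latter are
    written as i + 1, ..., i + 6 modulo 7. *)
Lemma separating_cubic i : exists f : {mpoly K[3]}, [/\ f \is 3.-homog,
  forall j, j != i -> evalpt f (p j) = 0 & evalpt f (p i) != 0].
Proof.
pose L a b := linform (crossv (v (i + a)) (v (i + b))).
have LE a b (x : 'rV[K]_3) : (L a b).@[x 0] = det3v (v (i + a)) (v (i + b)) x.
  exact: meval_linform.
exists (L 1 2%:R * (L 3%:R 4%:R * L 5%:R 6%:R)); split.
- by do !apply: (dhomogM (d := 1)); rewrite ?linform_homog.
- move=> j /ord7_shift ij; rewrite /evalpt !mevalM !LE.
  by case: ij => [[]|[]|[]] ->; rewrite /det3v ?dotv_crossl ?dotv_crossr ?mul0r ?mulr0.
- rewrite /evalpt !mevalM !LE.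
  by rewrite !mulf_neq0 // noncollinear // uniq_shift.
Qed.

(** The conic belongs to the pencil generated by two pairs of lines through
    [a], [b], [c], [d], and the coefficients are adjusted to make it contain [j].
    It is not zero, because it does not vanish at v a + v b, which lies on only
    one line of the two pairs. If it contained [i], six points would be on
    a conic. The last clause is the parallelogram law of quadratic forms. *)
Lemma separating_conic i j k a b c d : uniq [:: i; j; k; a; b; c; d] ->
  exists C : {mpoly K[3]}, [/\ C \is 2.-homog,
    C.@[v i 0] != 0, {in [:: j; a; b; c; d], forall l, C.@[v l 0] = 0}
    & forall x y : 'rV[K]_3,
        C.@[(x + y) 0] + C.@[(y - x) 0] = 2 * (C.@[x 0] + C.@[y 0])].
Proof.
move=> U.
pose L i j := linform (crossv (v i) (v j)).
have LE l m (x : 'rV[K]_3) : (L l m).@[x 0] = det3v (v l) (v m) x.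
  exact: meval_linform.
pose C := (det a c j * det b d j)%:MP * (L a b * L c d)
        - (det a b j * det c d j)%:MP * (L a c * L b d).
have CE (x : 'rV[K]_3) : C.@[x 0] =
    det a c j * det b d j * (det3v (v a) (v b) x * det3v (v c) (v d) x)
  - det a b j * det c d j * (det3v (v a) (v c) x * det3v (v b) (v d) x).
  by rewrite meval_pencil !LE.
have Ch : C \is 2.-homog.
  by rewrite rpredB // dhomog_mulC // (dhomogM (d := 1)) ?linform_homog.
have C0 : {in [:: j; a; b; c; d], forall l, C.@[v l 0] = 0}.
  move=> l; rewrite !inE CE.
  case/or4P => [/eqP->|/eqP->|/eqP->|/orP[]/eqP->];
    rewrite /det3v ?dotv_crossl ?dotv_crossr; ring.
exists C; split=> //; last first.
  by move=> x y; rewrite !CE /det3v !(dotvDr, dotvNr); ring.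
apply/eqP => Ci; have A6 : #|[set l in [:: i; j; a; b; c; d]]| = 6%N.
  rewrite cardsE (card_uniqP _) //; apply: subseq_uniq U.
  by rewrite /= !eqxx; do !case: eqP.
apply: gp.2 A6 _; exists C; split=> //; last first.
  move=> l; rewrite inE in_cons => /orP[/eqP->|]; first by [].
  exact: C0.
have D : [&& det a c b != 0, det b d a != 0, det a b j != 0 & det c d j != 0].
  by rewrite !noncollinear //; distinct_from U.
(* only the second product survives at a point of the line through a and b *)
apply: contraTneq D => C00; have := CE (v a + v b); rewrite C00 meval0.
have -> : det3v (v a) (v b) (v a + v b) = 0 by vec_ring.
have -> : det3v (v a) (v c) (v a + v b) = det a c b by vec_ring.
have -> : det3v (v b) (v d) (v a + v b) = det b d a by vec_ring.
rewrite mul0r mulr0 sub0r => /esym/eqP; rewrite oppr_eq0 !mulf_eq0.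
by case/orP=> /orP[] /eqP->; rewrite eqxx ?andbF.
Qed.

(** The line through [i] and [k] together with the conic through the other five
    points. On the line through [i] and [j] this cubic is divisible by s t; the
    sum in the last clause is twice its coefficient of s^2 t, nonzero since the
    conic does not contain [i]. *)
Lemma mixed_cubic i j k a b c d : uniq [:: i; j; k; a; b; c; d] ->
  exists f : {mpoly K[3]}, [/\ f \is 3.-homog,
    {in [:: i; j; k; a; b; c; d], forall l, f.@[v l 0] = 0}
    & f.@[(v i + v j) 0] + f.@[(v j - v i) 0] != 0].
Proof.
move=> U; have [C [Ch Ci C0 Cp]] := separating_conic U.
pose L := linform (crossv (v i) (v k)).
have LE (x : 'rV[K]_3) : L.@[x 0] = det3v (v i) (v k) x by exact: meval_linform.
exists (L * C); split; first by rewrite (dhomogM (d := 1)) // linform_homog.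
  move=> l; rewrite 3!in_cons mevalM LE /det3v => /or4P[/eqP->|/eqP->|/eqP->|lC].
  - by rewrite dotv_crossl mul0r.
  - by rewrite (C0 j) ?mulr0 // mem_head.
  - by rewrite dotv_crossr mul0r.
  - by rewrite (C0 l) ?mulr0 // in_cons lC orbT.
have E : det3v (v i) (v k) (v j - v i) = det i k j by vec_ring.
have E' : det3v (v i) (v k) (v i + v j) = det i k j by vec_ring.
rewrite !mevalM !LE E E' -mulrDr Cp (C0 j) ?mem_head // addr0.
rewrite !mulf_neq0 ?pnatr_eq0 // noncollinear //.
by distinct_from U.
Qed.
End GeneralPosition.

Section Cubics.
Variables (K : numClosedFieldType) (p : 'I_7 -> point K).
Hypothesis gp : general_position p.
Local Notation V := (dhomog 3 K 3).

(** Cubics form a space of dimension 10, the evaluation at the seven points is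
    onto by [separating_cubic], so its kernel has dimension 3 and is spanned by
    any three independent members. *)
Lemma cubic_system_span (u : 'I_3 -> {mpoly K[3]}) :
  (forall l, cubic_system p (u l)) ->
  (forall a : 'rV[K]_3, \sum_l a 0 l *: u l = 0 -> a = 0) ->
  forall f, cubic_system p f -> exists a : 'rV[K]_3, f = \sum_l a 0 l *: u l.
Proof.
move=> us ufree f [fh f0].
pose ev (g : V) : 'rV[K]_7 := \row_i evalpt (val g) (p i).
have ev_lin : linear ev.
  by move=> k g g'; apply/rowP => i; rewrite !mxE /evalpt mevalD mevalZ.
pose evL := GRing.isLinear.Build _ _ _ _ ev ev_lin.
pose ev' : {linear V -> 'rV[K]_7} := HB.pack ev evL.
pose phi : 'Hom(V, 'rV[K]_7) := linfun ev'.
have phiE g : phi g = ev g by rewrite lfunE.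
have full : limg phi = fullv.
  apply/vspaceP => w; rewrite [RHS]memvf; apply/idP.
  have /fin_all_exists[g gP] i : exists g : V, ev g = delta_mx 0 i.
    have [g [gh g0 gi]] := separating_cubic gp i.
    exists ((evalpt g (p i))^-1 *: DHomog gh); apply/rowP => j.
    rewrite !mxE eqxx /= /evalpt mevalZ; case: eqP => [->|/eqP ji].
      by rewrite mulVf.
    have gj : g.@[val (p j) 0] = 0 := g0 j ji.
    by rewrite gj mulr0.
  rewrite (row_sum_delta w); apply: memv_suml => i _; apply: memvZ.
  by rewrite -gP -phiE memv_img ?memvf.
have dimker : \dim (lker phi) = 3.
  have := limg_ker_dim phi fullv; rewrite full capfv !dimvf => dims.
  by apply: (@addIn 7); apply: etrans dims _.
pose w l : V := DHomog (us l).1.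
pose X : 3.-tuple V := [tuple w l | l < 3].
have Xl (l : 'I_3) : X`_l = w l by rewrite -tnth_nth tnth_mktuple.
have Xfree : free X.
  apply/freeP => k k0 l; pose a : 'rV[K]_3 := \row_l k l.
  have : a = 0.
    apply: ufree; apply: etrans (congr1 val k0); rewrite raddf_sum.
    by apply: eq_bigr => m _; rewrite mxE Xl.
  by move/rowP/(_ l); rewrite !mxE.
have Xker : <<X>>%VS = lker phi.
  apply/eqP; rewrite eqEdim dimker (eqP Xfree) size_tuple leqnn andbT.
  apply/span_subvP => _ /tnthP[l ->]; rewrite tnth_mktuple memv_ker phiE.
  by apply/eqP/rowP => i; rewrite !mxE; exact: (us l).2.
have : DHomog fh \in <<X>>%VS.
  rewrite Xker memv_ker phiE; apply/eqP/rowP => i; rewrite !mxE; exact: f0.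
move/coord_span => /(congr1 val) fE.
exists (\row_l coord X l (DHomog fh)); rewrite -[LHS]/(val (DHomog fh)) fE.
rewrite raddf_sum; apply: eq_bigr => l _.
by rewrite mxE Xl.
Qed.
End Cubics.

(** * Degrees of the coordinates of the involution *)

Section HomogeneousVectors.
Variable K : fieldType.
Variable c : 'I_3 -> 'I_3 -> 'I_3 -> 'I_3 -> K.
Local Notation P := {mpoly K[3]}.
Local Notation cP := (fun l i j k => (c l i j k)%:MP : P).
Implicit Types (x y z : 'rV[P]_3).

Definition vhomog (d : nat) x := forall i, x 0 i \is d.-homog.

Lemma vhomog_varv : vhomog 1 (varv K).
Proof. by move=> i; rewrite mxE dhomogX; apply/eqP; exact: mdeg1. Qed.

Lemma vhomogC (x : 'rV[K]_3) : vhomog 0 (map_mx (@mpolyC 3 K) x).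
Proof. by move=> i; rewrite mxE -[_%:MP]mulr1; apply/dhomog_mulC/dhomog1. Qed.

Lemma dotv_homog d d' x y : vhomog d x -> vhomog d' y ->
  dotv x y \is (d + d').-homog.
Proof. by move=> hx hy; apply: rpred_sum => i _; apply: dhomogM. Qed.

Lemma crossv_homog d d' x y : vhomog d x -> vhomog d' y ->
  vhomog (d + d') (crossv x y).
Proof. by move=> hx hy i; rewrite mxE rpredB // dhomogM. Qed.

Lemma trilin_homog (b : 'I_3 -> 'I_3 -> 'I_3 -> K) d1 d2 d3 x y z :
  vhomog d1 x -> vhomog d2 y -> vhomog d3 z ->
  trilin (fun i j k => (b i j k)%:MP : P) x y z \is (d1 + (d2 + d3)).-homog.
Proof.
move=> hx hy hz; apply: rpred_sum => i _; apply: dhomogM => //.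
apply: rpred_sum => j _; apply: dhomogM => //.
by apply: rpred_sum => k _; rewrite mulrC dhomog_mulC.
Qed.

Lemma cubic_map_homog d x : vhomog d x -> vhomog (d + (d + d)) (cubic_map cP x).
Proof. by move=> hx l; rewrite mxE trilin_homog. Qed.

Lemma cubic_polar_homog d d' x y : vhomog d x -> vhomog d' y ->
  vhomog (d + (d + d')) (cubic_polar cP x y).
Proof.
move=> hx hy l; rewrite mxE; apply: rpredD; first apply: rpredD.
- exact: trilin_homog.
- by rewrite [(d + d')%N]addnC trilin_homog.
- by rewrite addnA addnC trilin_homog.
Qed.

Variable e : 'rV[K]_3.
Local Notation eP := (map_mx (@mpolyC 3 K) e).

Lemma tangent_dir_homog : vhomog 3 (tangent_dir cP eP (varv K)).
Proof.
exact: (crossv_homog (d := 3) (cubic_map_homog vhomog_varv) (vhomogC e)).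
Qed.

Lemma tangency_st_homog : tangency_st cP eP (varv K) \is 8.-homog.
Proof.
exact: (dotv_homog tangent_dir_homog
          (cubic_polar_homog vhomog_varv tangent_dir_homog)).
Qed.

Lemma tangency_tt_homog : tangency_tt cP eP (varv K) \is 10.-homog.
Proof.
rewrite rpredN.
exact: (dotv_homog vhomog_varv (cubic_map_homog tangent_dir_homog)).
Qed.

Lemma second_root_homog : vhomog 11 (second_root cP eP (varv K)).
Proof.
move=> i; rewrite mxE [X in X + _]mxE [X in _ + X]mxE [X in _ - X]mxE.
apply: rpredB; first exact: (dhomogM tangency_tt_homog (vhomog_varv i)).
exact: (dhomogM tangency_st_homog (tangent_dir_homog i)).
Qed.
End HomogeneousVectors.

(** * The quadratic foliation singular at the seven points *)

Section Foliation.
Variables (K : numClosedFieldType) (p : 'I_7 -> point K) (F : foliation K 2).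
Hypothesis gp : general_position p.
Hypothesis sing : forall q, singular F q <-> exists i, same_point q (p i).
Variable c : 'I_3 -> 'I_3 -> 'I_3 -> 'I_3 -> K.
Local Notation P := {mpoly K[3]}.
Local Notation cP := (fun l i j k => (c l i j k)%:MP : P).
Hypothesis cE : forall l, F l = trilin (cP l) (varv K) (varv K) (varv K).
Local Notation v i := (val (p i)).
Implicit Types (x y m : 'rV[K]_3).

Lemma meval_tensor x l i j k : (cP l i j k).@[x 0] = c l i j k.
Proof. exact: mevalC. Qed.

Lemma meval_fol l x : (F l).@[x 0] = cubic_map c x 0 l.
Proof. by rewrite cE (rmorph_trilin _ _ _ (meval_tensor x l)) meval_varv mxE. Qed.

Lemma eval3_fol (q : point K) : eval3 F q = cubic_map c (val q).
Proof. by apply/rowP => l; rewrite mxE /evalpt meval_fol. Qed.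

Lemma fol_euler_eval x : dotv x (cubic_map c x) = 0.
Proof.
have := congr1 (meval (x 0)) (fol_euler F); rewrite rmorph_sum rmorph0 /= => E.
apply: etrans E; apply: eq_bigr => i _.
by rewrite mevalM mevalXU meval_fol.
Qed.
Local Notation euler := fol_euler_eval.

Lemma cubic_map_eq0P x : x != 0 -> cubic_map c x = 0 <-> exists i, (x == v i)%MS.
Proof.
move=> x0; have := sing (exist _ x x0); rewrite /singular eval3_fol /=.
by move=> [sx xs]; split=> [/eqP/sx//|/xs/eqP].
Qed.

Lemma cubic_map_base i : cubic_map c (v i) = 0.
Proof. by apply/(cubic_map_eq0P (valP (p i))); exists i; apply/andP. Qed.

Lemma fol_cubic_system l : cubic_system p (F l).
Proof.
by split=> [|i]; [exact: fol_homog | rewrite /evalpt meval_fol cubic_map_base mxE].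
Qed.

Lemma meval_fol_comb (a x : 'rV[K]_3) :
  (\sum_l a 0 l *: F l).@[x 0] = dotv a (cubic_map c x).
Proof.
by rewrite raddf_sum; apply: eq_bigr => l _; rewrite -meval_fol; exact: mevalZ.
Qed.

(** A relation a . F = 0 says that every tangent line passes through [a]. But
    a line that avoids [a] and the seven points is tangent at some point, which
    would have to be singular. *)
Lemma fol_free (a : 'rV[K]_3) : \sum_l a 0 l *: F l = 0 -> a = 0.
Proof.
move=> aF; apply/eqP; apply/negPn/negP => a0.
have [|l] := @avoid_planes K (a :: [seq v i | i <- enum 'I_7]).
  by rewrite /= a0; apply/allP => _ /mapP[i _ ->]; exact: (valP (p i)).
case/andP=> la /allP lv.
have l0 : l != 0 by apply: contraNneq la => ->; rewrite dotv0l.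
have [x [y [xy [k k0 xyl]]]] := ex_plane_basis l0.
have [m [m0 lm [k' Fm]]] := exists_tangency euler xy.
have k'0 : k' = 0.
  have := meval_fol_comb a m; rewrite aF meval0 Fm xyl !dotvZr dotvC => /esym/eqP.
  by rewrite !mulf_eq0 (negbTE la) (negbTE k0) !orbF => /eqP.
have [i /row_eqmxP[k'' k''0 mi]] : exists i, (m == v i)%MS.
  by apply/cubic_map_eq0P => //; rewrite Fm k'0 scale0r.
have /negP[] := lv (v i) (map_f _ (mem_enum _ i)).
move: lm; rewrite xyl dotvZl mi dotvZr => /eqP.
by rewrite !mulf_eq0 (negbTE k0) (negbTE k''0).
Qed.

Lemma cubic_system_comb f : cubic_system p f ->
  exists a : 'rV[K]_3, forall x, f.@[x 0] = dotv a (cubic_map c x).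
Proof.
move=> fp; have [a ->] := cubic_system_span gp fol_cubic_system fol_free fp.
by exists a => x; exact: meval_fol_comb.
Qed.

(** The cubics of the system vanishing at m are the a . F with a orthogonal to
    F(m); they all vanish at q exactly when F(q) is a multiple of F(m). *)
Lemma pencil_base_pointP (m q : point K) : ~~ singular F m ->
  pencil_base_point p m q <-> (eval3 F q <= eval3 F m)%MS.
Proof.
rewrite /singular !eval3_fol => Fm; split=> [mq|/sub_rVP[k Fq] f].
  have par : crossv (cubic_map c (val q)) (cubic_map c (val m)) = 0.
    apply: dotv_all0 => y; pose a := crossv (cubic_map c (val m)) y.
    have := mq (\sum_l a 0 l *: F l); rewrite /evalpt !meval_fol_comb.
    have -> : dotv a (cubic_map c (val q)) =
      dotv (crossv (cubic_map c (val q)) (cubic_map c (val m))) y by rewrite /a; vec_ring.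
    apply; last by rewrite /a; vec_ring.
    split; first by apply: rpred_sum => l _; apply/rpredZ/fol_homog.
    by move=> i; rewrite /evalpt meval_fol_comb cubic_map_base dotv0r.
  by apply/sub_rVP; apply: crossv_eq0.
move=> /cubic_system_comb[a fE]; rewrite /evalpt !fE Fq dotvZr => ->.
by rewrite mulr0.
Qed.

(** Incidence of [q] with its own tangent line is the Euler relation, so only
    the equality of the two lines matters. *)
Lemma line_tangent_atP (m q : point K) : ~~ singular F m ->
  line_tangent_at F (tangent_line F m) q <->
  ~~ singular F q /\ (eval3 F q <= eval3 F m)%MS.
Proof.
move=> Fm; split=> [[Fq _ /andP[]]|[Fq qm]] //; split=> //.
  have /sub_rVP[k Fk] := qm; rewrite /on_line /tangent_line.
  move: Fk Fq; rewrite /singular !eval3_fol => Fk Fq.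
  have k0 : k != 0 by apply: contraNneq Fq => k0; rewrite Fk k0 scale0r.
  have : k * dotv (cubic_map c (val m)) (val q) = 0.
    by rewrite -dotvZl -Fk dotvC euler.
  by move/eqP; rewrite mulf_eq0 (negbTE k0) => /eqP.
move: qm Fq; rewrite /tangent_line /singular => /sub_rVP[k Fk] Fq.
by apply/row_eqmxP; exists k => //; apply: contraNneq Fq => k0; rewrite Fk k0 scale0r.
Qed.

Lemma second_tangency_ninth_base (m m' : point K) :
  second_tangency_point F m m' <-> ninth_base_point p m m'.
Proof.
split=> [[Fm mm' tan]|[mp m'p mm' base]].
  have Fm' : ~~ singular F m'.
    by have [_ /(_ (or_intror (same_point_refl m')))[]] := tan m'.
  split=> // [i|i|q].
  - by apply: contra Fm => mi; apply/sing; exists i.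
  - by apply: contra Fm' => mi; apply/sing; exists i.
  split=> [/(pencil_base_pointP _ Fm) qm|qs].
    have [/sing|Fq] := boolP (singular F q); first by constructor 1.
    have /tan[] : line_tangent_at F (tangent_line F m) q by apply/line_tangent_atP.
      by constructor 2.
    by constructor 3.
  apply/pencil_base_pointP => //; case: qs => [/sing/eqP->|qm|qm].
  - by rewrite sub0mx.
  - by have /(line_tangent_atP _ Fm)[] := (tan q).2 (or_introl qm).
  - by have /(line_tangent_atP _ Fm)[] := (tan q).2 (or_intror qm).
have nonsing (x y : point K) : (forall i, ~~ same_point y (p i)) ->
    same_point x y -> ~~ singular F x.
  move=> yp xy; apply/negP => Fx; have [i xi] := (sing x).1 Fx.
  by apply/negP: (yp i); rewrite negbK (same_point_trans _ xi) // same_point_sym.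
have Fm : ~~ singular F m := nonsing m m mp (same_point_refl m).
split=> // q; apply: (iff_trans (line_tangent_atP _ Fm)); split=> [[Fq qm]|qm].
  have := (base q).1 ((pencil_base_pointP q Fm).2 qm).
  by case=> [qp|?|?]; [case/negP: Fq; apply/sing | left | right].
split; first by case: qm; exact: nonsing.
by apply/(pencil_base_pointP q Fm)/base; case: qm; [constructor 2 | constructor 3].
Qed.

Lemma foliation_involution_geiser f :
  foliation_involution F f <-> geiser_involution p f.
Proof.
split=> -[f_inv [h [h0 hh hP]]]; split=> //; exists h; split=> // x /hP[x' [xx' fx]];
  exists x'; split=> //; exact/second_tangency_ninth_base.
Qed.

(** Otherwise every cubic of the system would have no term in s^2 t on the line
    through [i] and [j], which fails for [mixed_cubic]. *)
Lemma cubic_polar_base_neq0 i j k a b d e : uniq [:: i; j; k; a; b; d; e] ->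
  cubic_polar c (v i) (v j) != 0.
Proof.
move=> U; have [f [fh f0]] := mixed_cubic gp U; apply: contraNneq => D0.
have [w fE] : exists w : 'rV[K]_3, forall x, f.@[x 0] = dotv w (cubic_map c x).
  apply: cubic_system_comb; split=> // l; apply: f0.
  (* seven distinct indices exhaust the set *)
  have /(uniq_min_size U)[] : {subset [:: i; j; k; a; b; d; e] <= enum 'I_7}.
    by move=> ? _; rewrite mem_enum.
    by rewrite size_enum_ord.
  by move=> _ ->; rewrite mem_enum.
rewrite !fE -dotvDr.
have -> : v i + v j = 1 *: v i + 1 *: v j by rewrite !scale1r.
have -> : v j - v i = (- 1) *: v i + 1 *: v j by rewrite scaleN1r scale1r addrC.
rewrite !cubic_map_comb !cubic_map_base D0 !scaler0 !(addr0, add0r) -scalerDl dotvZr.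
by apply/eqP; ring.
Qed.

Lemma uniq7 : uniq ([:: 0; 1; 2%:R; 3%:R; 4%:R; 5%:R; 6%:R] : seq 'I_7) /\
  uniq ([:: 1; 0; 2%:R; 3%:R; 4%:R; 5%:R; 6%:R] : seq 'I_7).
Proof. by []. Qed.

Lemma on_line_base (i j k : 'I_7) : uniq [:: i; j] ->
  dotv (crossv (v i) (v j)) (v k) = 0 -> k = i \/ k = j.
Proof.
move=> ij; have [->|ki] := eqVneq k i; first by left.
have [->|kj] := eqVneq k j; first by right.
move/eqP/negPn/negP; case; apply: (noncollinear gp).
by rewrite /= in ij *; rewrite !inE !negb_or [i == k]eq_sym ki [j == k]eq_sym kj
  !andbT in ij *.
Qed.

(** Write x and y for the two base points. As F vanishes at x and at y,
    F(s x + t y) = s t (s G + t H) and the tangency form is a multiple of s t. If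
    it were zero, G and H would be multiples g and h of the line, both nonzero by
    [cubic_polar_base_neq0], and h x - g y would be an eighth singular point. *)
Lemma tangency_disc_base : tangency_disc c (v 0) (v 1) != 0.
Proof.
rewrite /tangency_disc !cubic_map_base dotv0r mul0r mulr0 addr0 sqrf_eq0.
set x := v 0; set y := v 1; set G := cubic_polar c x y; set H := cubic_polar c y x.
have xy : crossv x y != 0.
  have : det3v x y (v 2%:R) != 0 by exact: (@noncollinear _ _ gp 0 1 2%:R).
  by apply: contraNneq => xy; rewrite /det3v xy dotv0l.
apply/eqP => Gy.
have [Gx Hx] := euler_polar euler x y; have [Hy _] := euler_polar euler y x.
rewrite -/G -/H in Gx Hx Hy.
have [g GE] : exists g, G = g *: crossv x y.
  by apply: orth2_parallel; rewrite // dotvC // Gx cubic_map_base dotv0r oppr0.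
have [h HE] : exists h, H = h *: crossv x y.
  apply: orth2_parallel; rewrite // dotvC; first by rewrite Hx Gy oppr0.
  by rewrite Hy cubic_map_base dotv0r oppr0.
have g0 : g != 0.
  have := cubic_polar_base_neq0 uniq7.1; rewrite -/x -/y -/G GE.
  by apply: contraNneq => ->; rewrite scale0r.
have h0 : h != 0.
  have := cubic_polar_base_neq0 uniq7.2; rewrite -/x -/y -/H HE.
  by apply: contraNneq => ->; rewrite scale0r.
pose q := h *: x + (- g) *: y.
have q0 : q != 0 by apply: comb_neq0 => //; rewrite h0.
have [i /row_eqmxP[k k0 qi]] : exists i, (q == v i)%MS.
  apply/(cubic_map_eq0P q0); rewrite cubic_map_comb !cubic_map_base -/G -/H GE HE.
  by vec_ring.
have : i = 0 \/ i = 1.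
  apply: on_line_base => //; apply: (mulfI k0); rewrite -dotvZr -qi.
  by rewrite dotv_cross_comb mulr0.
case=> iE; rewrite iE in qi.
  have : crossv x q = 0 by rewrite qi crossvZr crossvv scaler0.
  have -> : crossv x q = (- g) *: crossv x y by rewrite /q; vec_ring.
  by move/eqP; rewrite scaler_eq0 (negbTE xy) oppr_eq0 (negbTE g0).
have : crossv q y = 0 by rewrite qi crossvZl crossvv scaler0.
have -> : crossv q y = h *: crossv x y by rewrite /q; vec_ring.
by move/eqP; rewrite scaler_eq0 (negbTE xy) (negbTE h0).
Qed.

(** Move the line through p_0 and p_1 in a one-parameter family, translating
    both points along p_2: its discriminant and its products with the p_i are
    polynomials in the parameter, and none of them is zero. For p_0 and p_1
    the product vanishes at t = 0, but not at t = 1. *)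
Lemma good_line : exists x y, [/\ crossv x y != 0, tangency_disc c x y != 0
  & forall i, dotv (crossv x y) (v i) != 0].
Proof.
pose C : 'rV[K]_3 -> 'rV[{poly K}]_3 := map_mx (@polyC K).
pose xp := C (v 0) + 'X *: C (v 2%:R); pose yp := C (v 1) + 'X *: C (v 2%:R).
pose cp l i j k := (c l i j k)%:P.
pose x t := v 0 + t *: v 2%:R; pose y t := v 1 + t *: v 2%:R.
have CE t (w : 'rV[K]_3) : map_mx (horner_eval t) (C w) = w.
  by apply/rowP => i; rewrite !mxE; exact: hornerC.
have XE t : horner_eval t 'X = t by exact: hornerX.
have xE t : map_mx (horner_eval t) xp = x t.
  by rewrite map_mxD map_mxZ !CE; congr (_ + _ *: _); exact: XE.
have yE t : map_mx (horner_eval t) yp = y t.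
  by rewrite map_mxD map_mxZ !CE; congr (_ + _ *: _); exact: XE.
have cpE t l i j k : horner_eval t (cp l i j k) = c l i j k by exact: hornerC.
have tdE t : (tangency_disc cp xp yp).[t] = tangency_disc c (x t) (y t).
  by rewrite -[LHS]/(horner_eval t _) (rmorph_tangency_disc (cpE t)) xE yE.
have dtE t i : (dotv (crossv xp yp) (C (v i))).[t] = dotv (crossv (x t) (y t)) (v i).
  by rewrite -[LHS]/(horner_eval t _) rmorph_dotv map_crossv xE yE CE.
have nz (q : {poly K}) t : q.[t] != 0 -> q != 0.
  by apply: contraNneq => ->; rewrite horner0.
have /poly_nonroot[t] :
    tangency_disc cp xp yp * \prod_i dotv (crossv xp yp) (C (v i)) != 0.
  rewrite mulf_neq0 //.
    by apply: (nz _ 0); rewrite tdE /x /y !scale0r !addr0; exact: tangency_disc_base.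
  apply/prodf_neq0 => i _.
  have [->|i0] := eqVneq i 0.
    apply: (nz _ 1); rewrite dtE.
    have -> : dotv (crossv (x 1) (y 1)) (v 0) = det3v (v 2%:R) (v 1) (v 0).
      by rewrite /x /y; vec_ring.
    exact: (@noncollinear _ _ gp 2%:R 1 0).
  have [->|i1] := eqVneq i 1.
    apply: (nz _ 1); rewrite dtE.
    have -> : dotv (crossv (x 1) (y 1)) (v 1) = det3v (v 0) (v 2%:R) (v 1).
      by rewrite /x /y; vec_ring.
    exact: (@noncollinear _ _ gp 0 2%:R 1).
  apply: (nz _ 0); rewrite dtE /x /y !scale0r !addr0; apply/eqP => /on_line_base.
  by case=> // /eqP; apply/negP.
rewrite hornerM mulf_eq0 negb_or tdE horner_prod => /andP[td /prodf_neq0 dt].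
exists (x t), (y t).
have {}dt i : dotv (crossv (x t) (y t)) (v i) != 0 by rewrite -dtE dt.
by split=> //; apply: contraNneq (dt 0) => ->; rewrite dotv0l.
Qed.

(** Take for [m] one of the two tangency points of a good line, and for [e]
    a line containing neither of them. *)
Lemma generic_point : exists m e, [/\ dotv m e != 0, tangency_st c e m != 0,
  tangency_tt c e m != 0 & forall i, dotv (cubic_map c m) (v i) != 0].
Proof.
have [x [y [xy td lp]]] := good_line.
have [m0 [m1 [[m01 [lm0 lm1] [k0 F0] [k1 F1]] [q [lq nq]]]]] :=
  two_tangencies euler xy td.
have m0n : m0 != 0.
  by apply: contraNneq m01 => ->; rewrite crossv0l.
have m1n : m1 != 0.
  by apply: contraNneq m01 => ->; rewrite crossv0r.
have [|e /and3P[]] := @avoid_planes K [:: m0; m1]; first by rewrite /= m0n m1n.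
rewrite ![dotv e _]dotvC => e0 e1 _.
have k0n : k0 != 0.
  apply/eqP => k00; have [i /row_eqmxP[k kn mi]] : exists i, (m0 == v i)%MS.
    by apply/(cubic_map_eq0P m0n); rewrite F0 k00 scale0r.
  move: (lp i); apply/negP; rewrite negbK; apply/eqP/(mulfI kn).
  by rewrite -dotvZr -mi lm0 mulr0.
have F0n : cubic_map c m0 != 0 by rewrite F0 scaler_eq0 negb_or k0n.
have [] := tangency_coefs_neq0 euler e0 e1 F0n m01.
- by rewrite F0 dotvZl lm1 mulr0.
- by exists (k1 / k0); rewrite F0 scalerA divfK.
- exists q; rewrite {1}F0 dotvZl lq mulr0; split=> // -[k Fq]; apply: nq.
  by exists (k * k0); rewrite Fq F0 scalerA.
move=> A0 B0; exists m0, e; split=> // i.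
by rewrite F0 dotvZl mulf_neq0.
Qed.

(** * The rational involution *)

Section InvolutionMap.
Variable e : 'rV[K]_3.
Local Notation eP := (map_mx (@mpolyC 3 K) e).

Lemma map_mevalC x (w : 'rV[K]_3) :
  map_mx (meval (x 0)) (map_mx (@mpolyC 3 K) w) = w.
Proof. by apply/rowP => i; rewrite !mxE; exact: mevalC. Qed.

Lemma meval_second_root i x :
  (second_root cP eP (varv K) 0 i).@[x 0] = second_root c e x 0 i.
Proof.
have := congr1 (fun w : 'rV_3 => w 0 i) (map_second_root (meval_tensor x) eP (varv K)).
by rewrite map_mevalC meval_varv mxE.
Qed.

(** The open condition on [x] under which [second_root c e x] is the second
    tangency point. The last clause, that no p_i is on the tangent line at [x],
    makes both tangency points regular; the third one keeps the image off
    the line [e], so that the formula applies again at the image. *)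
Definition nondegenerate x := [&& dotv x e != 0, tangency_st c e x != 0,
  tangency_tt c e x != 0 & [forall i, dotv (cubic_map c x) (v i) != 0]].

Lemma nondegenerate_generic m : nondegenerate m ->
  generically (fun x : point K => nondegenerate (val x)).
Proof.
move=> mP.
pose h : P := dotv (varv K) eP * (tangency_st cP eP (varv K)
    * (tangency_tt cP eP (varv K)
    * \prod_i dotv (cubic_map cP (varv K)) (map_mx (@mpolyC 3 K) (v i)))).
have hE x : h.@[x 0] = dotv x e * (tangency_st c e x * (tangency_tt c e x
    * \prod_i dotv (cubic_map c x) (v i))).
  rewrite /h !mevalM rmorph_dotv (rmorph_tangency_st (meval_tensor x)).
  rewrite (rmorph_tangency_tt (meval_tensor x)) rmorph_prod map_mevalC meval_varv.
  congr (_ * (_ * (_ * _))); apply: eq_bigr => i _.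
  by rewrite rmorph_dotv (map_cubic_map (meval_tensor x)) map_mevalC meval_varv.
have hP x : (h.@[x 0] != 0) = nondegenerate x.
  rewrite hE !mulf_eq0 !negb_or; congr [&& _, _, _ & _].
  by apply/prodf_neq0/forallP => H i; have := H i; rewrite // => /(_ isT).
exists h; split; last by move=> x; rewrite /evalpt hP.
  by apply: contraTneq mP => h0; rewrite -hP h0 meval0 eqxx.
exists (1 + 0 + (8 + (10 + \sum_(i < 7) 3)))%N.
apply: dhomogM; first exact: dotv_homog (@vhomog_varv K) (vhomogC e).
apply: dhomogM; first exact: tangency_st_homog.
apply: dhomogM; first exact: tangency_tt_homog.
elim/big_rec2: _ => [|i d q _ hq]; first exact: dhomog1.
apply: dhomogM => //.
exact: (dotv_homog (cubic_map_homog c (@vhomog_varv K)) (vhomogC (v i))).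
Qed.

Lemma involution_map m : nondegenerate m ->
  exists f : ratmap K, forall x : point K, eval3 f x = second_root c e (val x).
Proof.
case/and4P => me Am Bm _.
have Ihomog i : second_root cP eP (varv K) 0 i \is 11.-homog.
  exact: second_root_homog.
have neq0 : exists i, second_root cP eP (varv K) 0 i != 0.
  have : second_root c e m != 0.
    apply: contraNneq (mulf_neq0 Bm me) => I0.
    by rewrite -dotv_second_root_e I0 dotv0l.
  case/rV3_neq0 => i Ii; exists i; apply: contraNneq Ii => f0.
  by rewrite -meval_second_root f0 meval0.
exists (RatMap Ihomog neq0) => x; apply/rowP => i; rewrite mxE.
exact: meval_second_root.
Qed.

Lemma second_tangency_at_root (x y : point K) : nondegenerate (val x) ->
  val y = second_root c e (val x) -> second_tangency_point F x y.
Proof.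
case/and4P => xe Ax _ /forallP xp yE.
have Fx : cubic_map c (val x) != 0.
  by apply: contraNneq (xp 0) => ->; rewrite dotv0l.
have nx : ~~ singular F x by rewrite /singular eval3_fol.
have ninv : crossv (val y) (val x) != 0 by rewrite yE (crossv_second_root_neq0 euler).
split=> // [|q]; first by apply: contraNN ninv => /row_eqmxP[k _ ->];
  rewrite crossvZl crossvv scaler0.
apply: (iff_trans (line_tangent_atP q nx)); rewrite !eval3_fol.
have on_line_tan (z : 'rV[K]_3) k :
    k != 0 -> cubic_map c z = k *: cubic_map c (val x) ->
    dotv (cubic_map c (val x)) z = 0.
  by move=> k0 Fz; apply: (mulfI k0); rewrite -dotvZl -Fz dotvC euler mulr0.
have notbase z : z != 0 -> dotv (cubic_map c (val x)) z = 0 -> cubic_map c z != 0.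
  move=> z0 xz; apply/eqP => /(cubic_map_eq0P z0)[i /row_eqmxP[k k0 zi]].
  move: (xp i); apply/negP; rewrite negbK; apply/eqP/(mulfI k0).
  by rewrite -dotvZr -zi xz mulr0.
have crit := second_rootP euler Fx xe Ax (valP q).
rewrite /same_point yE; split=> [[Fq /sub_rVP[k Fk]]|qxy].
  apply/crit; last by exists k.
  move: Fq; rewrite /singular eval3_fol Fk => Fq; apply: on_line_tan Fk.
  by apply: contraNneq Fq => ->; rewrite scale0r.
have xq : dotv (cubic_map c (val x)) (val q) = 0.
  case: qxy => /row_eqmxP[k k0 ->]; rewrite dotvZr.
    by rewrite dotvC euler mulr0.
  by rewrite (dotv_tangent_second_root euler) mulr0.
split; first by rewrite /singular eval3_fol notbase // (valP q).
by apply/sub_rVP/crit.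
Qed.

Lemma foliation_involution_exists m : nondegenerate m ->
  exists f : ratmap K, foliation_involution F f.
Proof.
move=> mP; have [f fE] := involution_map mP.
have [h [h0 hh hP]] := nondegenerate_generic mP.
have image (x : point K) : nondegenerate (val x) ->
    exists y : point K, val y = second_root c e (val x).
  move=> /and4P[xe _ Bx _].
  suff y0 : second_root c e (val x) != 0.
    by exists (exist (fun w : 'rV[K]_3 => is_true (w != 0)) _ y0).
  apply: contraNneq (mulf_neq0 Bx xe) => I0.
  by rewrite -dotv_second_root_e I0 dotv0l.
exists f; split; exists h; split=> // x /hP xP; have [y yE] := image x xP; exists y.
  split; first by rewrite /ratmap_at fE yE; apply/andP.
  have [nx _ tan] := second_tangency_at_root xP yE.
  have /(line_tangent_atP _ nx)[] := (tan y).2 (or_intror (same_point_refl y)).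
  rewrite /singular !eval3_fol => Fy /sub_rVP[k Fk].
  have k0 : k != 0 by apply: contraNneq Fy => k0; rewrite Fk k0 scale0r.
  have /and4P[_ Ax Bx _] := xP.
  rewrite yE in Fk; rewrite /ratmap_at fE yE; apply/row_eqmxP.
  exists ((k * tangency_tt c e (val x)) ^+ 3); first by rewrite expf_neq0 // mulf_neq0.
  by rewrite (second_root_involutive euler Fk).
split; first exact: second_tangency_at_root.
by rewrite /ratmap_at fE yE; apply/andP.
Qed.
End InvolutionMap.
End Foliation.

Section Uniqueness.
Variables (K : numClosedFieldType) (F : foliation K 2).

Lemma second_tangency_unique (m m1 m2 : point K) :
  second_tangency_point F m m1 -> second_tangency_point F m m2 ->
  same_point m2 m1.
Proof.
move=> [_ _ t1] [_ m2m t2].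
have /t1[] // := (t2 m2).2 (or_intror (same_point_refl m2)).
by rewrite (negbTE m2m).
Qed.

(** Both maps have the same value on a nonempty open set. Multiplying the 2 by 2
    minors by equations of its complement, and by one coordinate to stay away
    from the origin, gives polynomials that vanish everywhere. *)
Lemma foliation_involution_unique (f g : ratmap K) :
  foliation_involution F f -> foliation_involution F g -> ratmap_eq f g.
Proof.
move=> [_ [h1 [h1n _ h1P]]] [_ [h2 [h2n _ h2P]]] i j.
apply/eqP; rewrite -subr_eq0; apply/negPn/negP => fg.
have X0 : 'X_o0 != 0 :> {mpoly K[3]}.
  apply/eqP => X0; have := mevalXU (fun=> 1 : K) o0.
  by rewrite X0 meval0 => /esym/eqP; rewrite oner_eq0.
have /mpoly_nonvanishing[x] :
    (f i * g j - f j * g i) * (h1 * (h2 * 'X_o0)) != 0 by rewrite !mulf_neq0.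
rewrite !mevalM mevalXU mevalB !mevalM !mulf_eq0 !negb_or.
case/and4P => fgx h1x h2x x0.
have xn : x != 0 by apply: contraNneq x0 => ->; rewrite mxE.
pose m : point K := exist _ x xn.
have [m1 [t1 /row_eqmxP[a _ fm]]] := h1P m h1x.
have [m2 [t2 /row_eqmxP[b _ gm]]] := h2P m h2x.
have /row_eqmxP[k _ m21] := second_tangency_unique t1 t2.
have fE l : (f l).@[x 0] = a * val m1 0 l.
  by have := congr1 (fun w : 'rV_3 => w 0 l) fm; rewrite !mxE.
have gE l : (g l).@[x 0] = b * (k * val m1 0 l).
  by have := congr1 (fun w : 'rV_3 => w 0 l) gm; rewrite m21 !mxE.
by case/eqP: fgx; rewrite !fE !gE; ring.
Qed.
End Uniqueness.

Theorem mainTheorem1 (R : realType) (p : 'I_7 -> point R[i])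
    (F : foliation R[i] 2) :
  general_position p ->
  (forall q : point R[i], singular F q <-> exists i : 'I_7, same_point q (p i)) ->
  [/\ exists IF : ratmap R[i], foliation_involution F IF,
      exists IG : ratmap R[i], geiser_involution p IG
    & forall IF IG : ratmap R[i],
        foliation_involution F IF -> geiser_involution p IG -> ratmap_eq IF IG].
Proof.
move=> gp sing.
have /fin_all_exists[c cE] l := dhomog3_trilin (fol_homog F l).
have [m [e [me Am Bm mp]]] := generic_point gp sing cE.
have [f fF] : exists f, foliation_involution F f.
  apply: (@foliation_involution_exists _ p F sing c cE e m).
  by apply/and4P; split=> //; apply/forallP.
have FG := foliation_involution_geiser gp sing cE.
split; first by exists f.
  by exists f; apply/FG.
by move=> g1 g2 Fg1 /FG; exact: foliation_involution_unique.
Qed.
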